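(* Let $p\ge 3$ be a prime, let $N$ be a positive integer coprime to $p$, and let $\alpha\ge 0$ be an integer. (1) If $p\equiv 1 \pmod 5$, then $\overline{p}(5p^{10\alpha+9}N)\equiv 0 \pmod 5$. (2) If $p\equiv 2,3,$ or $4 \pmod 5$, then $\overline{p}(5p^{8\alpha+7}N)\equiv 0 \pmod 5$.
   Context: An overpartition of a nonnegative integer $n$ is a partition of $n$ in which the first occurrence of each distinct part may (or may not) be overlined; $\overline{p}(n)$ denotes the number of overpartitions of $n$ (with $\overline{p}(0)=1$). Equivalently, $\sum_{n\ge0}\overline{p}(n)q^n=\prod_{k\ge1}\frac{1+q^k}{1-q^k}$. *)

(* Defs.v *)
From mathcomp Require Import all_boot.
Set Implicit Arguments. Unset Strict Implicit. Unset Printing Implicit Defensive.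

(* opb m n = number of overpartitions of n all of whose parts are <= m.
   Recursion on the largest allowed part size j = m: either j does not
   occur (opb (m-1) n ways), or j occurs with multiplicity k >= 1
   (k * j <= n), in which case the first occurrence of j may or may not
   be overlined (factor 2).  This is the combinatorial content of
   \sum_n \bar p(n) q^n = \prod_{j>=1} (1+q^j)/(1-q^j). *)
Fixpoint opb (m n : nat) : nat :=
  match m with
  | 0 => (n == 0)
  | m'.+1 =>
      let fix mult (k : nat) : nat :=
        match k with
        | 0 => 0
        | k'.+1 => mult k' +
                   (if k'.+1 * m'.+1 <= n then 2 * opb m' (n - k'.+1 * m'.+1)
                    else 0)
        end
      in opb m' n + mult n
  end.

(* \bar p(n): the number of overpartitions of n (parts are at most n). *)
Definition overpartition (n : nat) : nat := opb n n.

(* Main.v *)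
Require Import Defs.
From mathcomp Require Import all_boot all_order all_algebra.
From mathcomp Require Import zify ring.

(** Gauss' identity says that the generating function of overpartitions is the
    inverse of [phi(-q) = \sum_j (-1)^j q^(j^2)].  Modulo 5 it therefore equals
    [phi(-q)^4 / phi(-q^5)].  Sorting the four-square representations of [5 n] by
    the six left ideals of norm 5 in the integral quaternions gives
    [r4(5 n) = r4(n)] modulo 5, so extracting the exponents divisible by 5 yields
    [overpartition (5 n) = (-1)^n r3(n)] modulo 5.

    For an odd prime [p] dividing [n], the Hecke relation
    [(p + 1) r3(n) = r3(p^2 n) + p r3(n / p^2)] comes from counting the vectors of
    norm [p^2 n] in the lattices [q Z^3 q^*], one for each isotropic line of
    [F_p^3], where the quaternion [q] of norm [p] is found by Lagrange's descent.
    It follows that [r3(p^(2k+1) N) = (1 + p + ... + p^k) r3(p N)] when [p] does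
    not divide [N], and the geometric sum vanishes modulo 5 for the given [k]. *)

Set Implicit Arguments. Unset Strict Implicit. Unset Printing Implicit Defensive.
Import Order.TTheory GRing.Theory Num.Theory.
Local Open Scope ring_scope.

(** * Quaternions and Lagrange's descent *)

Definition quat (R : Type) : Type := (R * R * R * R)%type.
Definition vec3 (R : Type) : Type := (R * R * R)%type.

Definition qnorm (R : pzRingType) (q : quat R) : R :=
  let: (a, b, c, d) := q in a ^+ 2 + b ^+ 2 + c ^+ 2 + d ^+ 2.
Definition qconj (R : pzRingType) (q : quat R) : quat R :=
  let: (a, b, c, d) := q in (a, - b, - c, - d).
Definition qmul (R : pzRingType) (q r : quat R) : quat R :=
  let: (a, b, c, d) := q in let: (e, f, g, h) := r in
  (a * e - b * f - c * g - d * h, a * f + b * e + c * h - d * g,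
   a * g - b * h + c * e + d * f, a * h + b * g - c * f + d * e).
Definition qscale (R : pzRingType) (k : R) (q : quat R) : quat R :=
  let: (a, b, c, d) := q in (k * a, k * b, k * c, k * d).
Definition qadd (R : pzRingType) (q r : quat R) : quat R :=
  let: (a, b, c, d) := q in let: (e, f, g, h) := r in
  (a + e, b + f, c + g, d + h).
Definition qdvd (m : int) (q : quat int) : bool :=
  let: (a, b, c, d) := q in
  [&& (m %| a)%Z, (m %| b)%Z, (m %| c)%Z & (m %| d)%Z].
Definition pure (R : pzRingType) (v : vec3 R) : quat R :=
  let: (x, y, z) := v in (0, x, y, z).
Definition norm3 (R : pzRingType) (v : vec3 R) : R :=
  let: (x, y, z) := v in x ^+ 2 + y ^+ 2 + z ^+ 2.

Lemma qmulA (R : comPzRingType) (q r s : quat R) :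
  qmul q (qmul r s) = qmul (qmul q r) s.
Proof.
case: q r s => [[[a b] c] d] [[[e f] g] h] [[[i j] k] l] /=.
by congr (_, _, _, _); ring.
Qed.

Lemma qnormM (R : comPzRingType) (q r : quat R) :
  qnorm (qmul q r) = qnorm q * qnorm r.
Proof. by case: q r => [[[a b] c] d] [[[e f] g] h] /=; ring. Qed.

Lemma qnormZ (R : comPzRingType) (k : R) (q : quat R) :
  qnorm (qscale k q) = k ^+ 2 * qnorm q.
Proof. by case: q => [[[a b] c] d] /=; ring. Qed.

Lemma qmulZr (R : comPzRingType) (k : R) (q r : quat R) :
  qmul q (qscale k r) = qscale k (qmul q r).
Proof.
case: q r => [[[a b] c] d] [[[e f] g] h] /=.
by congr (_, _, _, _); ring.
Qed.

Lemma qdvd_mulr (m : int) (q r : quat int) : qdvd m q -> qdvd m (qmul q r).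
Proof.
case: q r => [[[a b] c] d] [[[e f] g] h] /= /and4P[ma mb mc md].
by rewrite !(rpredB, rpredD) // dvdz_mulr.
Qed.

Lemma qdvd_scale (m k : int) (q : quat int) :
  coprimez m k -> qdvd m (qscale k q) -> qdvd m q.
Proof.
by case: q => [[[a b] c] d] mk /=; rewrite !(Gauss_dvdzr _ mk).
Qed.

(** When the norm is even, the coordinates split into two pairs of equal parity; right
    multiplication by [1 + i], [1 + j] or [1 + k] then makes all of them even. *)
Lemma even_qnorm_half (q : quat int) :
  (2 %| qnorm q)%Z -> exists h r, qnorm h = 2 /\ qscale 2 r = qmul q h.
Proof.
case: q => [[[a b] c] d] /= ev.
have sq (x : int) : x ^+ 2 = x + 2 * (((x ^+ 2 - x) %/ 2)%Z).
  have : (2 %| x ^+ 2 - x)%Z.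
    have -> : x ^+ 2 - x = x * (x - 1) by ring.
    have [e|e] : (2 %| x)%Z \/ (2 %| x - 1)%Z by lia.
      exact: dvdz_mulr.
    exact: dvdz_mull.
  by lia.
have {}ev : (2 %| a + b + c + d)%Z by move: ev (sq a) (sq b) (sq c) (sq d); lia.
have [[e1 e2]|[[e1 e2]|[e1 e2]]] :
  ((2 %| a + b)%Z /\ (2 %| c + d)%Z) \/ ((2 %| a + c)%Z /\ (2 %| b + d)%Z) \/
  ((2 %| a + d)%Z /\ (2 %| b + c)%Z) by lia.
- exists (1, 1, 0, 0), ((a - b) %/ 2, (a + b) %/ 2, (c + d) %/ 2, (d - c) %/ 2)%Z.
  by split; [rewrite /=; ring | congr (_, _, _, _); lia].
- exists (1, 0, 1, 0), ((a - c) %/ 2, (b - d) %/ 2, (a + c) %/ 2, (b + d) %/ 2)%Z.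
  by split; [rewrite /=; ring | congr (_, _, _, _); lia].
- exists (1, 0, 0, 1), ((a - d) %/ 2, (b + c) %/ 2, (c - b) %/ 2, (a + d) %/ 2)%Z.
  by split; [rewrite /=; ring | congr (_, _, _, _); lia].
Qed.

(** Twice a residue is even, hence never the odd number [- m]; the resulting strict bound is what
    makes the descent decrease. *)
Lemma balanced_residue (m : nat) (x : int) :
  odd m -> exists s, (2 * (x - m%:Z * s)) ^+ 2 < m%:Z ^+ 2.
Proof.
move=> om; exists ((2 * x + m%:Z) %/ (2 * m%:Z))%Z.
set k := (_ %/ _)%Z.
have [h1 h2] : - m%:Z <= 2 * (x - m%:Z * k) < m%:Z /\ 2 * (x - m%:Z * k) <> - m%:Z.
  rewrite /k; split; last by lia.
  by nia.
by nia.
Qed.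

(* Lagrange's descent for the four-square theorem, carried out inside the right
   ideal of the quaternions [q] with [w q = 0] modulo [p]. *)
Lemma quat_descent (p : nat) (w : quat int) (m : nat) (q : quat int) :
  prime p -> odd p -> (0 < m < p)%N ->
  qnorm q = p%:Z * m%:Z -> qdvd p (qmul w q) ->
  exists2 r, qnorm r = p%:Z & qdvd p (qmul w r).
Proof.
move=> pp op; elim/ltn_ind: m q => m IH q /andP[m0 mp] Nq wq.
have [m1|m1] := eqVneq m 1%N; first by exists q; rewrite // Nq m1 mulr1.
(* For even [m], multiplying by [h] of norm 2 and halving replaces [m] by [m / 2]. *)
have [em|om] := boolP (odd m); last first.
  have [h [r [Nh rE]]] : exists h r, qnorm h = 2 /\ qscale 2 r = qmul q h.
    by apply: even_qnorm_half; rewrite Nq; apply: dvdz_mull; lia.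
  have Nr : qnorm r = p%:Z * m./2%:Z.
    have := congr1 (@qnorm _) rE; rewrite qnormZ qnormM Nq Nh.
    have -> : m%:Z = 2 * m./2%:Z by lia.
    by set x := qnorm r; set y := m./2%:Z; nia.
  apply: (IH m./2 _ r) => //; [by lia | by lia |].
  apply: (@qdvd_scale _ 2); last by rewrite -qmulZr rE qmulA qdvd_mulr.
  by rewrite -[coprimez _ _]/(coprime p 2) coprimen2.
case: q Nq wq => [[[a b] c] d] Nq wq.
have [sa ha] := balanced_residue a em.
have [sb hb] := balanced_residue b em.
have [sc hc] := balanced_residue c em.
have [sd hd] := balanced_residue d em.
(* With [r = q - m s] the small residue, [q r^*] is divisible by [m]; the quotient is
   [t = p - q s^*], of norm [p k] where [qnorm r = m k]. *)
pose s : quat int := (sa, sb, sc, sd).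
pose r : quat int := (a - m%:Z * sa, b - m%:Z * sb, c - m%:Z * sc, d - m%:Z * sd).
pose t := qadd (p%:Z, 0, 0, 0) (qscale (-1) (qmul (a, b, c, d) (qconj s))).
have qrE : qmul (a, b, c, d) (qconj r) =
    qadd (qnorm (a, b, c, d), 0, 0, 0)
         (qscale (- m%:Z) (qmul (a, b, c, d) (qconj s))).
  by rewrite /r /s /=; congr (_, _, _, _); ring.
have tE : qscale m%:Z t = qmul (a, b, c, d) (qconj r).
  by rewrite qrE Nq /t /s /=; congr (_, _, _, _); ring.
have [k kE] : exists k, qnorm r = m%:Z * k.
  exists (p%:Z - 2 * (a * sa + b * sb + c * sc + d * sd) + m%:Z * qnorm s).
  rewrite mulrDr mulrBr [m%:Z * p%:Z]mulrC -Nq /r /s /=.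
  by ring.
have rlt : qnorm r < m%:Z ^+ 2.
  by move: ha hb hc hd; rewrite !exprMn /r /=; clear; lia.
have r0 : 0 <= qnorm r by rewrite /= !addr_ge0 // sqr_ge0.
(* If [r = 0], then [m] divides [q] and [m^2] divides [p m], impossible for [1 < m < p]. *)
have rn0 : qnorm r != 0.
  rewrite /= !paddr_eq0 ?addr_ge0 ?sqr_ge0 // !sqrf_eq0 !subr_eq0.
  apply/negP => /andP[/andP[/andP[/eqP aE /eqP bE] /eqP cE] /eqP dE].
  have /mulfI pE : (m%:Z : int) != 0 by clear -m0; lia.
  have {}pE : p%:Z = m%:Z * qnorm s.
    by apply: pE; rewrite mulrC -Nq aE bE cE dE /=; ring.
  have : (m %| p)%N by rewrite -[(m %| p)%N]/(m%:Z %| p%:Z)%Z pE dvdz_mulr.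
  by case/primeP: pp => _ /[apply] /pred2P[] mE; move: m1 mp; rewrite mE ?ltnn.
have Nt : qnorm t = p%:Z * k.
  have := congr1 (@qnorm _) tE; rewrite qnormZ qnormM Nq.
  have -> : qnorm (qconj r) = qnorm r by rewrite /=; ring.
  rewrite kE => e.
  have /mulfI : (m%:Z ^+ 2 : int) != 0 by rewrite expf_neq0 //; lia.
  apply; rewrite e; ring.
have kb : 0 < k < m%:Z.
  by move: rlt r0 rn0; rewrite kE; move: m0; clear; nia.
have kN : k = `|k|%N%:Z by move: kb; clear; lia.
apply: (IH `|k|%N _ t) => //; [by move: kb; clear; lia
  | by move: kb mp; clear; lia | by rewrite -kN |].
apply: (@qdvd_scale _ m%:Z); last by rewrite -qmulZr tE qmulA qdvd_mulr.
rewrite -[coprimez _ _]/(coprime p m) prime_coprime //.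
by apply/negP => /dvdn_leq; lia.
Qed.

(** * Vectors in dimension three and their rotation by quaternions *)

Definition dot3 (R : pzRingType) (v w : vec3 R) : R :=
  let: (a, b, c) := v in let: (x, y, z) := w in a * x + b * y + c * z.
Definition cross3 (R : pzRingType) (v w : vec3 R) : vec3 R :=
  let: (a, b, c) := v in let: (x, y, z) := w in
  (b * z - c * y, c * x - a * z, a * y - b * x).
Definition scale3 (R : pzRingType) (k : R) (v : vec3 R) : vec3 R :=
  let: (a, b, c) := v in (k * a, k * b, k * c).
Definition add3 (R : pzRingType) (v w : vec3 R) : vec3 R :=
  let: (a, b, c) := v in let: (x, y, z) := w in (a + x, b + y, c + z).
Definition map3 (R S : Type) (f : R -> S) (v : vec3 R) : vec3 S :=
  let: (a, b, c) := v in (f a, f b, f c).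
Definition map4 (R S : Type) (f : R -> S) (q : quat R) : quat S :=
  let: (a, b, c, d) := q in (f a, f b, f c, f d).
Definition dvd3 (m : int) (v : vec3 int) : bool :=
  let: (a, b, c) := v in [&& (m %| a)%Z, (m %| b)%Z & (m %| c)%Z].

(** The Euler-Rodrigues matrix of [v |-> q v q^*] on pure quaternions, left unnormalised so that it
    stays integral. *)
Definition qrot (R : pzRingType) (q : quat R) (v : vec3 R) : vec3 R :=
  let: (a, b, c, d) := q in let: (x, y, z) := v in
  ((a ^+ 2 + b ^+ 2 - c ^+ 2 - d ^+ 2) * x
     + 2 * (b * c - a * d) * y + 2 * (b * d + a * c) * z,
   2 * (b * c + a * d) * x
     + (a ^+ 2 - b ^+ 2 + c ^+ 2 - d ^+ 2) * y + 2 * (c * d - a * b) * z,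
   2 * (b * d - a * c) * x
     + 2 * (c * d + a * b) * y + (a ^+ 2 - b ^+ 2 - c ^+ 2 + d ^+ 2) * z).

Ltac vec_ring :=
  rewrite /qrot /cross3 /scale3 /add3 /qmul /qconj /pure /=;
  by [congr (_, _, _, _); ring | congr (_, _, _); ring].

Lemma pure_rot (R : comPzRingType) (q : quat R) (v : vec3 R) :
  pure (qrot q v) = qmul (qmul q (pure v)) (qconj q).
Proof. case: q v => [[[a b] c] d] [[x y] z]; vec_ring. Qed.

Lemma qrotK (R : comPzRingType) (q : quat R) (v : vec3 R) :
  qrot (qconj q) (qrot q v) = scale3 (qnorm q ^+ 2) v.
Proof. case: q v => [[[a b] c] d] [[x y] z]; vec_ring. Qed.

Lemma qrot_conjK (R : comPzRingType) (q : quat R) (v : vec3 R) :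
  qrot q (qrot (qconj q) v) = scale3 (qnorm q ^+ 2) v.
Proof. case: q v => [[[a b] c] d] [[x y] z]; vec_ring. Qed.

Lemma norm3_rot (R : comPzRingType) (q : quat R) (v : vec3 R) :
  norm3 (qrot q v) = qnorm q ^+ 2 * norm3 v.
Proof. by case: q v => [[[a b] c] d] [[x y] z] /=; ring. Qed.

(** Conjugating [q] transposes the matrix. *)
Lemma dot3_rot (R : comPzRingType) (q : quat R) (v w : vec3 R) :
  dot3 (qrot q v) w = dot3 v (qrot (qconj q) w).
Proof. by case: q v w => [[[a b] c] d] [[x y] z] [[u r] s] /=; ring. Qed.

Lemma qrotZ (R : comPzRingType) (q : quat R) (k : R) (v : vec3 R) :
  qrot q (scale3 k v) = scale3 k (qrot q v).
Proof. case: q v => [[[a b] c] d] [[x y] z]; vec_ring. Qed.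

Lemma qrotD (R : comPzRingType) (q : quat R) (v w : vec3 R) :
  qrot q (add3 v w) = add3 (qrot q v) (qrot q w).
Proof. case: q v w => [[[a b] c] d] [[x y] z] [[u r] s]; vec_ring. Qed.

Lemma norm3Z (R : comPzRingType) (k : R) (v : vec3 R) :
  norm3 (scale3 k v) = k ^+ 2 * norm3 v.
Proof. by case: v => [[x y] z] /=; ring. Qed.

Lemma norm3D (R : comPzRingType) (v w : vec3 R) :
  norm3 (add3 v w) = norm3 v + 2 * dot3 v w + norm3 w.
Proof. by case: v w => [[x y] z] [[u r] s] /=; ring. Qed.

Lemma dot3Zl (R : comPzRingType) (k : R) (v w : vec3 R) :
  dot3 (scale3 k v) w = k * dot3 v w.
Proof. by case: v w => [[x y] z] [[u r] s] /=; ring. Qed.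

Lemma dot3Zr (R : comPzRingType) (k : R) (v w : vec3 R) :
  dot3 v (scale3 k w) = k * dot3 v w.
Proof. by case: v w => [[x y] z] [[u r] s] /=; ring. Qed.

Lemma dot3C (R : comPzRingType) (v w : vec3 R) : dot3 v w = dot3 w v.
Proof. by case: v w => [[x y] z] [[u r] s] /=; ring. Qed.

Lemma dot3vv (R : comPzRingType) (v : vec3 R) : dot3 v v = norm3 v.
Proof. by case: v => [[x y] z] /=; ring. Qed.

Lemma dot3_eq0 (R : comPzRingType) (w : vec3 R) :
  (forall v, dot3 v w = 0) -> w = (0, 0, 0).
Proof.
case: w => [[x y] z] /= w0; congr (_, _, _).
- by have /= := w0 (1, 0, 0); rewrite !mul0r mul1r !addr0.
- by have /= := w0 (0, 1, 0); rewrite !mul0r mul1r addr0 add0r.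
- by have /= := w0 (0, 0, 1); rewrite !mul0r mul1r !add0r.
Qed.

Lemma qmul_pure (R : comPzRingType) (v w : vec3 R) :
  qmul (pure v) (pure w) =
  (- dot3 v w, (cross3 v w).1.1, (cross3 v w).1.2, (cross3 v w).2).
Proof. case: v w => [[x y] z] [[u r] s]; vec_ring. Qed.

Lemma map3_rot (R S : comPzRingType) (f : {rmorphism R -> S}) q v :
  map3 f (qrot q v) = qrot (map4 f q) (map3 f v).
Proof.
case: q v => [[[a b] c] d] [[x y] z] /=.
by rewrite !(rmorphD, rmorphN, rmorphM, rmorphXn, rmorph1).
Qed.

Lemma map4_qmul (R S : comPzRingType) (f : {rmorphism R -> S}) q r :
  map4 f (qmul q r) = qmul (map4 f q) (map4 f r).
Proof.
case: q r => [[[a b] c] d] [[[e g] h] i] /=.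
by rewrite !(rmorphD, rmorphN, rmorphM).
Qed.

Lemma map4_qconj (R S : comPzRingType) (f : {rmorphism R -> S}) q :
  map4 f (qconj q) = qconj (map4 f q).
Proof. by case: q => [[[a b] c] d] /=; rewrite !rmorphN. Qed.

Lemma map4_pure (R S : comPzRingType) (f : {rmorphism R -> S}) v :
  map4 f (pure v) = pure (map3 f v).
Proof. by case: v => [[a b] c] /=; rewrite rmorph0. Qed.

Lemma qnorm_map4 (R S : comPzRingType) (f : {rmorphism R -> S}) q :
  qnorm (map4 f q) = f (qnorm q).
Proof.
by case: q => [[[a b] c] d] /=; rewrite !(rmorphD, rmorphXn).
Qed.

Lemma norm3_map3 (R S : comPzRingType) (f : {rmorphism R -> S}) v :
  norm3 (map3 f v) = f (norm3 v).
Proof. by case: v => [[a b] c] /=; rewrite !(rmorphD, rmorphXn). Qed.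

Lemma dot3_map3 (R S : comPzRingType) (f : {rmorphism R -> S}) v w :
  dot3 (map3 f v) (map3 f w) = f (dot3 v w).
Proof.
by case: v w => [[a b] c] [[x y] z] /=; rewrite !(rmorphD, rmorphM).
Qed.

(** * Isotropic lines and quaternions of norm zero over a field *)

Lemma cross3_eq0 (F : fieldType) (v w : vec3 F) :
  v != (0, 0, 0) -> cross3 v w = (0, 0, 0) -> exists k, w = scale3 k v.
Proof.
case: v w => [[a b] c] [[x y] z] v0 [/eqP h1 /eqP h2 /eqP h3].
move: h1 h2 h3; rewrite !subr_eq0 => /eqP h1 /eqP h2 /eqP h3.
have [a0|a0] := eqVneq a 0; last first.
  by exists (x / a); congr (_, _, _); apply: (mulfI a0); rewrite ?h3 -?h2; field.
have [b0|b0] := eqVneq b 0; last first.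
  by exists (y / b); congr (_, _, _); apply: (mulfI b0); rewrite ?h1 -?h3; field.
have c0 : c != 0 by apply: contraNneq v0 => c0; rewrite a0 b0 c0.
by exists (z / c); congr (_, _, _); apply: (mulfI c0); rewrite ?h2 -?h1; field.
Qed.

(* A nondegenerate ternary form has no totally isotropic plane. *)
Lemma isotropic_orthogonal (F : fieldType) (v w : vec3 F) :
  v != (0, 0, 0) -> norm3 v = 0 -> norm3 w = 0 -> dot3 v w = 0 ->
  exists k, w = scale3 k v.
Proof.
move=> v0 Nv Nw vw.
(* Expanding [v x (v x w)] gives zero, so [v x w = k v]. Expanding [(v x w) x w] gives zero too,
   hence [k^2 v = 0] and [v x w = 0]. *)
have [k kE] : exists k, cross3 v w = scale3 k v.
  apply: cross3_eq0 => //.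
  have -> : cross3 v (cross3 v w) =
      add3 (scale3 (dot3 v w) v) (scale3 (- norm3 v) w).
    by case: (v) (w) => [[a b] c] [[x y] z]; rewrite /dot3 /norm3; vec_ring.
  rewrite vw Nv; case: (v) (w) => [[a b] c] [[x y] z] /=.
  by rewrite oppr0 !mul0r addr0.
apply: cross3_eq0 => //.
have : scale3 k (cross3 v w) = (0, 0, 0).
  have -> : scale3 k (cross3 v w) = cross3 (scale3 k v) w.
    by case: (v) (w) => [[a b] c] [[x y] z]; vec_ring.
  rewrite -kE.
  have -> : cross3 (cross3 v w) w =
      add3 (scale3 (dot3 v w) w) (scale3 (- norm3 w) v).
    by case: (v) (w) => [[a b] c] [[x y] z]; rewrite /dot3 /norm3; vec_ring.
  rewrite vw Nw; case: (v) (w) => [[a b] c] [[x y] z] /=.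
  by rewrite oppr0 !mul0r addr0.
rewrite kE; case: (v) => [[a b] c] /= [/eqP ha /eqP hb /eqP hc].
have [->|k0] := eqVneq k 0; first by rewrite !mul0r.
move: ha hb hc; rewrite !mulf_eq0 !(negPf k0) /= => /eqP-> /eqP-> /eqP->.
by rewrite mulr0.
Qed.

(** The trace of the matrix plus [qnorm q] is [4 a^2]; once [a = 0], each diagonal entry plus
    [qnorm q] is twice a square. A vanishing matrix thus forces [q = 0]. *)
Lemma rot_neq0 (F : fieldType) (q : quat F) :
  (2 : F) != 0 -> qnorm q = 0 -> q != (0, 0, 0, 0) ->
  exists x, qrot q x != (0, 0, 0).
Proof.
case: q => [[[a b] c] d] F2 /= Nq q0.
case: (eqVneq (qrot (a, b, c, d) (1, 0, 0)) (0, 0, 0)) => [[h1 _ _]|];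
  last by exists (1, 0, 0).
case: (eqVneq (qrot (a, b, c, d) (0, 1, 0)) (0, 0, 0)) => [[_ h2 _]|];
  last by exists (0, 1, 0).
case: (eqVneq (qrot (a, b, c, d) (0, 0, 1)) (0, 0, 0)) => [[_ _ h3]|];
  last by exists (0, 0, 1).
move: h1 h2 h3; rewrite !mulr0 !mulr1 !add0r !addr0 => h1 h2 h3.
have sq0 (x : F) : 2 * 2 * x ^+ 2 = 0 -> x = 0.
  by move/eqP; rewrite !mulf_eq0 (negPf F2) /= orbb => /eqP.
have a0 : a = 0.
  apply: sq0; rewrite -[RHS](_ : (a ^+ 2 + b ^+ 2 - c ^+ 2 - d ^+ 2)
    + (a ^+ 2 - b ^+ 2 + c ^+ 2 - d ^+ 2) + (a ^+ 2 - b ^+ 2 - c ^+ 2 + d ^+ 2)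
    + (a ^+ 2 + b ^+ 2 + c ^+ 2 + d ^+ 2) = 0); last by rewrite h1 h2 h3 Nq !addr0.
  ring.
have b0 : b = 0.
  apply: sq0; rewrite -[RHS](_ : 2 * ((a ^+ 2 + b ^+ 2 - c ^+ 2 - d ^+ 2)
    + (a ^+ 2 + b ^+ 2 + c ^+ 2 + d ^+ 2)) = 0); last by rewrite h1 Nq addr0 mulr0.
  rewrite a0; ring.
have c0 : c = 0.
  apply: sq0; rewrite -[RHS](_ : 2 * ((a ^+ 2 - b ^+ 2 + c ^+ 2 - d ^+ 2)
    + (a ^+ 2 + b ^+ 2 + c ^+ 2 + d ^+ 2)) = 0); last by rewrite h2 Nq addr0 mulr0.
  rewrite a0; ring.
have d0 : d = 0.
  apply: sq0; rewrite -[RHS](_ : 2 * ((a ^+ 2 - b ^+ 2 - c ^+ 2 + d ^+ 2)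
    + (a ^+ 2 + b ^+ 2 + c ^+ 2 + d ^+ 2)) = 0); last by rewrite h3 Nq addr0 mulr0.
  rewrite a0; ring.
by rewrite a0 b0 c0 d0 eqxx in q0.
Qed.

(** The product [v q x q^*] vanishes with [v q], and its vector part is the cross product of [v]
    with [q x q^*]. *)
Lemma rot_sub_line (F : fieldType) (v : vec3 F) (q : quat F) (x : vec3 F) :
  v != (0, 0, 0) -> qmul (pure v) q = (0, 0, 0, 0) ->
  exists k, qrot q x = scale3 k v.
Proof.
move=> v0 vq; apply: cross3_eq0 => //.
have := qmul_pure v (qrot q x).
rewrite pure_rot !qmulA vq.
have -> (r s : quat F) : qmul (qmul (0, 0, 0, 0) r) s = (0, 0, 0, 0).
  by case: r s => [[[? ?] ?] ?] [[[? ?] ?] ?]; vec_ring.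
by case: (cross3 _ _) => [[? ?] ?] /= [_ <- <- <-].
Qed.

Lemma line_sub_rot (F : fieldType) (v : vec3 F) (q : quat F) (k : F) :
  (2 : F) != 0 -> v != (0, 0, 0) -> qmul (pure v) q = (0, 0, 0, 0) ->
  qnorm q = 0 -> q != (0, 0, 0, 0) -> exists x, qrot q x = scale3 k v.
Proof.
move=> F2 v0 vq Nq q0.
have [x x0] := rot_neq0 F2 Nq q0.
have [l lE] := rot_sub_line x v0 vq.
have l0 : l != 0.
  by apply: contraNneq x0 => l0; rewrite lE l0; case: (v) => [[? ?] ?] /=; rewrite !mul0r.
exists (scale3 (k / l) x); rewrite qrotZ lE.
by case: (v) => [[a b] c] /=; rewrite !mulrA !divfK.
Qed.

(** The kernel of an adjoint is the orthogonal complement of the image, and the image of [qrot q] is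
    the line of [v]. *)
Lemma rot_conj_eq0 (F : fieldType) (v : vec3 F) (q : quat F) (y : vec3 F) :
  (2 : F) != 0 -> v != (0, 0, 0) -> qmul (pure v) q = (0, 0, 0, 0) ->
  qnorm q = 0 -> q != (0, 0, 0, 0) ->
  (qrot (qconj q) y == (0, 0, 0)) = (dot3 v y == 0).
Proof.
move=> F2 v0 vq Nq q0; apply/eqP/eqP => [y0 | vy].
  have [x xE] := line_sub_rot 1 F2 v0 vq Nq q0.
  rewrite -[dot3 v y]mul1r -dot3Zl -xE dot3_rot y0.
  by case: (x) => [[a b] c] /=; rewrite !mulr0 !addr0.
apply: dot3_eq0 => x; rewrite -dot3_rot.
by have [k ->] := rot_sub_line x v0 vq; rewrite dot3Zl vy mulr0.
Qed.

(** * Isotropic vectors over finite fields *)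

(** Every square has at most two roots, and zero has only one, whence the strict inequality. *)
Lemma card_squares (F : finFieldType) :
  (#|F| < 2 * #|[set x ^+ 2 | x : F]|)%N.
Proof.
set S := [set x ^+ 2 | x : F].
have S0 : 0 \in S by apply/imsetP; exists 0; rewrite ?expr0n.
have -> : #|F| = (\sum_(s in S) \sum_(x : F | x ^+ 2 == s) 1)%N.
  rewrite -sum1_card (partition_big (fun x : F => x ^+ 2) (mem S)) //=.
  by move=> x _; apply: imset_f.
rewrite mulnC -sum_nat_const.
rewrite (bigD1 0) // [ltnRHS](bigD1 0) //= -addSn.
apply: leq_add.
  rewrite (bigD1 (0 : F)) ?expr0n //= big1 ?addn0 //.
  by move=> x; rewrite sqrf_eq0 => /andP[/eqP->]; rewrite eqxx.
apply: leq_sum => s /andP[/imsetP[x _ ->] _].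
rewrite sum1_card (leq_trans (subset_leq_card (_ : _ \subset [set x; - x]))) //.
  by apply/subsetP => y; rewrite unfold_in -/(y ^+ 2 == x ^+ 2) eqf_sqr !inE.
by rewrite cards2; case: eqP.
Qed.

(** The squares and their images under [s |-> -1 - s] each fill more than half of the field, so they
    meet. *)
Lemma sum_two_squaresN1 (F : finFieldType) :
  exists a b : F, a ^+ 2 + b ^+ 2 = -1.
Proof.
set S := [set x ^+ 2 | x : F]; set T := [set -1 - s | s in S].
have cT : #|T| = #|S|.
  by apply: card_imset => x y /addrI /oppr_inj.
have : S :&: T != set0.
  rewrite -card_gt0 -(ltn_add2l #|S :|: T|) cardsUI cT addnn -mul2n addn0.
  exact: leq_ltn_trans (max_card _) (card_squares F).
case/set0Pn => s /setIP[/imsetP[a _ ->] /imsetP[_ /imsetP[b _ ->] e]].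
by exists a, b; rewrite e subrK.
Qed.

(** For first coordinate [u = 0] the third one vanishes and the second is free; for [u != 0] the
    third is free and determines the second. *)
Lemma card_hyperbolic (F : finFieldType) :
  #|[set t : vec3 F | t.1.1 * t.1.2 == t.2 ^+ 2]| = (#|F| ^ 2)%N.
Proof.
rewrite -sum1_card.
have -> : (\sum_(t in [set t : vec3 F | (t.1.1 * t.1.2 == t.2 ^+ 2)%R]) 1 =
  \sum_(u : F) \sum_(y : F) \sum_(v : F | (u * v == y ^+ 2)%R) 1)%N.
  rewrite [RHS]pair_big /= [RHS]pair_big_dep /=.
  rewrite (reindex (fun t : vec3 F => (t.1.1, t.2, t.1.2))) /=; last first.
    by exists (fun t : vec3 F => (t.1.1, t.2, t.1.2)) => [[[u v] y]|[[u v] y]].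
  by apply: eq_big => [[[u v] y]|[[u v] y]]; rewrite ?inE.
rewrite (bigD1 0) //= (bigD1 0) //= [X in (X + _ + _)%N](_ : _ = #|F|); last first.
  by rewrite (eq_bigl predT) ?sum1_card //= => v; rewrite mul0r expr0n eqxx.
rewrite big1 ?addn0; last first.
  move=> y y0; apply: big1 => v.
  by rewrite mul0r eq_sym sqrf_eq0 (negPf y0).
rewrite (eq_bigr (fun _ => #|F|)); last first.
  move=> u u0; rewrite -sum1_card; apply: eq_bigr => y _.
  rewrite (big_pred1 (y ^+ 2 / u)) // => v.
  by apply/eqP/eqP => [<-|->]; field.
rewrite sum_nat_const cardC1 mulnC -mulnS.
by rewrite (ltn_predK (_ : (0 < #|F|)%N)) ?mulnn //; apply/card_gt0P; exists 0.
Qed.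

(* With [a^2 + b^2 = -1], the substitution [X = a x + b y], [Y = b x - a y]
   turns [x^2 + y^2 + z^2 = 0] into [(z - X) (z + X) = Y^2]. *)
Lemma card_isotropic (F : finFieldType) : (2 : F) != 0 ->
  #|[set v : vec3 F | norm3 v == 0]| = (#|F| ^ 2)%N.
Proof.
move=> F2; have [a [b ab]] := sum_two_squaresN1 F.
rewrite -(card_hyperbolic F).
pose f (v : vec3 F) : vec3 F := let: (x, y, z) := v in
  (z - (a * x + b * y), z + (a * x + b * y), b * x - a * y).
(* Solving back uses [a X + b Y = (a^2 + b^2) x = - x], whence the signs. *)
pose g (t : vec3 F) : vec3 F := let: (u, v, y) := t in
  (- (a * ((v - u) / 2) + b * y), - (b * ((v - u) / 2) - a * y), (u + v) / 2).
have fg : bijective f.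
  exists g => [[[x y] z]|[[u v] y]]; rewrite /f /g; congr (_, _, _).
  - transitivity (- (a ^+ 2 + b ^+ 2) * x); last by rewrite ab; ring.
    by field.
  - transitivity (- (a ^+ 2 + b ^+ 2) * y); last by rewrite ab; ring.
    by field.
  - by field.
  - transitivity ((u + v) / 2 + (a ^+ 2 + b ^+ 2) * ((v - u) / 2)); first by field.
    by rewrite ab; field.
  - transitivity ((u + v) / 2 - (a ^+ 2 + b ^+ 2) * ((v - u) / 2)); first by field.
    by rewrite ab; field.
  - transitivity (- (a ^+ 2 + b ^+ 2) * y); first by field.
    by rewrite ab; ring.
rewrite -[RHS](on_card_preimset (onW_bij _ fg)).
apply: eq_card => [[[x y] z]]; rewrite !inE /=.
rewrite -[RHS]subr_eq0; congr (_ == _).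
transitivity (z ^+ 2 - (a ^+ 2 + b ^+ 2) * (x ^+ 2 + y ^+ 2)).
  by rewrite ab; ring.
by ring.
Qed.

Lemma card_isotropic_neq0 (F : finFieldType) : (2 : F) != 0 ->
  #|[set v : vec3 F | (v != (0, 0, 0)) && (norm3 v == 0)]|
    = (#|F|.-1 * #|F|.+1)%N.
Proof.
move=> F2; have := card_isotropic F2.
rewrite (cardsD1 (0, 0, 0)) inE /= !expr0n !addr0 eqxx.
have -> : [set v : vec3 F | norm3 v == 0] :\ (0, 0, 0) =
    [set v : vec3 F | (v != (0, 0, 0)) && (norm3 v == 0)].
  by apply/setP => v; rewrite !inE.
have : (0 < #|F|)%N by apply/card_gt0P; exists 0.
case: #|F| => // m _ e; apply: (@addnI 1); rewrite e -mulnn /=.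
by clear; lia.
Qed.

Lemma card_isotropic_orthogonal (F : finFieldType) (u : vec3 F) :
  u != (0, 0, 0) -> norm3 u = 0 ->
  #|[set v : vec3 F | [&& v != (0, 0, 0), norm3 v == 0 & dot3 v u == 0]]|
    = #|F|.-1.
Proof.
move=> u0 Nu.
have injs : injective (fun k : F => scale3 k u).
  case: u u0 {Nu} => [[a b] c] u0 k l /= [ha hb hc].
  apply: contraNeq u0 => kl.
  have E x : k * x = l * x -> x = 0.
    move/eqP; rewrite -subr_eq0 -mulrBl mulf_eq0 subr_eq0 (negPf kl).
    by move/eqP.
  by rewrite (E a) // (E b) // (E c).
rewrite -(cardC1 (0 : F)) -(card_imset (predC1 0) injs).
apply: eq_card => v; rewrite inE; apply/and3P/imsetP => [[v0 /eqP Nv /eqP vu]|].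
  have [k kE] := isotropic_orthogonal u0 Nu Nv (etrans (dot3C _ _) vu).
  exists k => //; rewrite inE; apply: contraNneq v0 => k0.
  by rewrite kE k0; case: (u) => [[a b] c] /=; rewrite !mul0r.
case=> k; rewrite inE => k0 ->; split.
- apply: contraNneq k0 => e; apply/eqP; apply: injs; rewrite /= e.
  by case: (u) => [[a b] c] /=; rewrite !mul0r.
- by rewrite norm3Z Nu mulr0.
- by rewrite dot3Zl dot3vv Nu mulr0.
Qed.

(** * Reduction modulo p and a quaternion of norm p for each isotropic line *)

Lemma dvd3_Fp (p : nat) (v : vec3 int) : prime p ->
  dvd3 p v = (map3 (intmul 1) v == (0, 0, 0) :> vec3 'F_p).
Proof.
move=> pp; case: v => [[a b] c] /=.
by rewrite !xpair_eqE !(dvdz_pcharf (pchar_Fp pp)) andbA.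
Qed.

Lemma qdvd_Fp (p : nat) (q : quat int) : prime p ->
  qdvd p q = (map4 (intmul 1) q == (0, 0, 0, 0) :> quat 'F_p).
Proof.
move=> pp; case: q => [[[a b] c] d] /=.
by rewrite !xpair_eqE !(dvdz_pcharf (pchar_Fp pp)) !andbA.
Qed.

Lemma Fp_balanced_lift (p : nat) (u : 'F_p) : prime p -> odd p ->
  exists2 x : int, x%:~R = u & (2 * x) ^+ 2 < p%:Z ^+ 2.
Proof.
move=> pp op; have [s sE] := balanced_residue (val u)%:Z op.
exists ((val u)%:Z - p%:Z * s) => //.
rewrite rmorphB rmorphM /= -!pmulrn natr_Zp.
by rewrite (pcharf0 (pchar_Fp pp)) mul0r subr0.
Qed.

(** The descent starts with both [w] and [q] equal to a balanced lift of [v]: its square is minus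
    its norm, a multiple of [p]. *)
Lemma isotropic_quat (p : nat) (v : vec3 'F_p) : prime p -> odd p ->
  v != (0, 0, 0) -> norm3 v = 0 ->
  exists2 q : quat int, qnorm q = p%:Z &
    qmul (pure v) (map4 (intmul 1) q) = (0, 0, 0, 0).
Proof.
move=> pp op; case: v => [[v1 v2] v3] v0 Nv.
have [x xE xlt] := Fp_balanced_lift v1 pp op.
have [y yE ylt] := Fp_balanced_lift v2 pp op.
have [z zE zlt] := Fp_balanced_lift v3 pp op.
have vE : (v1, v2, v3) = map3 (intmul 1) (x, y, z) by rewrite /= xE yE zE.
rewrite vE in v0 Nv *.
have : (p%:Z %| norm3 (x, y, z))%Z.
  by rewrite (dvdz_pcharf (pchar_Fp pp)) -norm3_map3 Nv.
case/dvdzP => m mE.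
have m0 : 0 < m.
  have n0 : norm3 (x, y, z) != 0.
    apply: contraNneq v0; rewrite /= => /eqP.
    rewrite !paddr_eq0 ?addr_ge0 ?sqr_ge0 // !sqrf_eq0.
    by case/andP => /andP[/eqP-> /eqP->] /eqP->.
  have : 0 <= norm3 (x, y, z) by rewrite /= !addr_ge0 // sqr_ge0.
  rewrite le_eqVlt eq_sym (negPf n0) /= -/(norm3 (x, y, z)) mE pmulr_lgt0 //.
  by have := prime_gt0 pp; clear; lia.
(* Each coordinate is below [p / 2] in absolute value, so the norm is below [3 p^2 / 4]. *)
have mp : m < p%:Z.
  have : norm3 (x, y, z) < p%:Z ^+ 2.
    by move: xlt ylt zlt; rewrite !exprMn /=; clear; lia.
  by rewrite mE; have := prime_gt0 pp; clear; nia.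
have [|||q Nq vq] := @quat_descent p (pure (x, y, z)) `|m|%N (pure (x, y, z)) pp op.
- by move: m0 mp; clear; lia.
- have -> : (`|m|%N)%:Z = m by move: m0; clear; lia.
  by rewrite mulrC -mE /= expr0n add0r.
- have -> : qmul (pure (x, y, z)) (pure (x, y, z)) = (- norm3 (x, y, z), 0, 0, 0).
    by vec_ring.
  by rewrite /= -/(norm3 (x, y, z)) mE !dvdz0 rpredN dvdz_mull.
exists q => //; apply/eqP.
by rewrite -map4_pure -map4_qmul -qdvd_Fp.
Qed.

(** * The Hecke relation for sums of three squares *)

Lemma dvd3_scale (m k : int) (v : vec3 int) :
  k != 0 -> dvd3 (k * m) (scale3 k v) = dvd3 m v.
Proof.
by move=> k0; case: v => [[a b] c] /=; rewrite !dvdz_mul2l.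
Qed.

Lemma dvd3_scaleP (m : int) (v : vec3 int) :
  dvd3 m v -> exists w, v = scale3 m w.
Proof.
case: v => [[a b] c] /= /and3P[/dvdzP[x ->] /dvdzP[y ->] /dvdzP[z ->]].
by exists (x, y, z); rewrite /= ![m * _]mulrC.
Qed.

Lemma dvd3D (m : int) (v w : vec3 int) :
  dvd3 m v -> dvd3 m w -> dvd3 m (add3 v w).
Proof.
case: v w => [[a b] c] [[x y] z] /= /and3P[? ? ?] /and3P[? ? ?].
by rewrite !rpredD.
Qed.

Lemma dvd3_scalel (m : int) (v : vec3 int) : dvd3 m (scale3 m v).
Proof. by case: v => [[a b] c] /=; rewrite !dvdz_mulr. Qed.

Lemma map3_add3 (R S : comPzRingType) (f : {rmorphism R -> S}) v w :
  map3 f (add3 v w) = add3 (map3 f v) (map3 f w).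
Proof. by case: v w => [[a b] c] [[x y] z] /=; rewrite !rmorphD. Qed.

Lemma map3_scale3 (R S : comPzRingType) (f : {rmorphism R -> S}) k v :
  map3 f (scale3 k v) = scale3 (f k) (map3 f v).
Proof. by case: v => [[a b] c] /=; rewrite !rmorphM. Qed.

Lemma Fp_lift3 (p : nat) (v : vec3 'F_p) :
  exists x : vec3 int, map3 (intmul 1) x = v.
Proof.
case: v => [[a b] c]; exists ((val a)%:Z, (val b)%:Z, (val c)%:Z).
by rewrite /= -!pmulrn !natr_Zp.
Qed.

Lemma Fp2_neq0 (p : nat) : prime p -> odd p -> (2 : 'F_p) != 0.
Proof.
move=> pp op; rewrite -(dvdn_pcharf (pchar_Fp pp)) dvdn_prime2 //.
by apply: contraTneq op => ->.
Qed.

Lemma quat_Fp_neq0 (p : nat) (q : quat int) : prime p -> qnorm q = p%:Z ->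
  map4 (intmul 1) q != (0, 0, 0, 0) :> quat 'F_p.
Proof.
move=> pp Nq; rewrite -qdvd_Fp //; apply/negP; case: q Nq => [[[a b] c] d] /=.
move=> Nq /and4P[/dvdzP[x xE] /dvdzP[y yE] /dvdzP[z zE] /dvdzP[t tE]].
have /mulIf pE : p%:Z != 0 :> int by have := prime_gt0 pp; clear; lia.
have : p%:Z * (x ^+ 2 + y ^+ 2 + z ^+ 2 + t ^+ 2) = 1.
  by apply: pE; rewrite mul1r -[RHS]Nq xE yE zE tE; ring.
move/(congr1 (fun x => `|x|%N)); rewrite abszM => /eqP.
by rewrite muln_eq1 => /andP[/eqP /= p1 _]; rewrite p1 in pp.
Qed.

(** Divisibility of [q^* y q] by [p^2] tests whether [y] lies in the lattice [q Z^3 q^*]. For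
    [y = p z] one factor [p] cancels and the test becomes [q^* z q = 0] modulo [p]. *)
Lemma rot_image_scaled (p : nat) (v : vec3 'F_p) (q : quat int) (z : vec3 int) :
  prime p -> odd p -> v != (0, 0, 0) -> qnorm q = p%:Z ->
  qmul (pure v) (map4 (intmul 1) q) = (0, 0, 0, 0) ->
  dvd3 (p%:Z ^+ 2) (qrot (qconj q) (scale3 p%:Z z))
    = (dot3 v (map3 (intmul 1) z) == 0).
Proof.
move=> pp op v0 Nq vq.
rewrite qrotZ expr2 dvd3_scale; last by have := prime_gt0 pp; clear; lia.
rewrite dvd3_Fp // map3_rot map4_qconj (@rot_conj_eq0 _ v) ?Fp2_neq0 ?quat_Fp_neq0 //.
by rewrite qnorm_map4 Nq /= -pmulrn pcharf0 ?pchar_Fp.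
Qed.

Lemma rot_image_primitive (p : nat) (v : vec3 'F_p) (q : quat int) (y : vec3 int) :
  prime p -> odd p -> v != (0, 0, 0) -> norm3 v = 0 -> qnorm q = p%:Z ->
  qmul (pure v) (map4 (intmul 1) q) = (0, 0, 0, 0) ->
  (p%:Z ^+ 2 %| norm3 y)%Z -> ~~ dvd3 p y ->
  dvd3 (p%:Z ^+ 2) (qrot (qconj q) y) = (dot3 v (map3 (intmul 1) y) == 0).
Proof.
move=> pp op v0 Nv Nq vq Ny yp.
have F2 := Fp2_neq0 pp op; have q0 := quat_Fp_neq0 pp Nq.
have cp := pchar_Fp pp.
have Nq0 : qnorm (map4 (intmul 1) q) = 0 :> 'F_p.
  by rewrite qnorm_map4 Nq /= -pmulrn pcharf0.
have p0 : p%:Z != 0 :> int by have := prime_gt0 pp; clear; lia.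
apply/idP/eqP => [|vy].
  move=> h; apply/eqP; rewrite -(rot_conj_eq0 _ F2 v0 vq Nq0 q0).
  rewrite -map4_qconj -map3_rot -dvd3_Fp //.
  have [[[a b] c] ->] := dvd3_scaleP h; rewrite /=.
  by rewrite expr2 -!mulrA !dvdz_mulr.
have Ny0 : norm3 (map3 (intmul 1) y) = 0 :> 'F_p.
  rewrite norm3_map3; apply/eqP; rewrite -(dvdz_pcharf cp).
  by apply: dvdz_trans Ny; rewrite expr2 dvdz_mulr.
have [k yE] := isotropic_orthogonal v0 Nv Ny0 vy.
have [xb xbE] := line_sub_rot k F2 v0 vq Nq0 q0.
have [x xE] := Fp_lift3 xb.
(* Modulo [p], [y] is isotropic and orthogonal to [v], hence on the line of [v], which is the image
   of the rotation. *)
have [w wE] : exists w, y = add3 (qrot q x) (scale3 p%:Z w).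
  have : dvd3 p (add3 y (scale3 (-1) (qrot q x))).
    rewrite dvd3_Fp // map3_add3 map3_scale3 map3_rot xE xbE yE.
    by case: (v) => [[a b] c] /=; rewrite rmorphN rmorph1 !mulN1r !subrr.
  case/dvd3_scaleP => w wE; exists w; rewrite -wE.
  by case: (y) (qrot q x) => [[a b] c] [[d e] f]; vec_ring.
(* Expanding [norm3 y] modulo [p^2] leaves [2 p] times the dot product of [q x q^*] and [w], and
   [q x q^*] reduces to [k v] with [k != 0]. *)
have vw : dot3 v (map3 (intmul 1) w) = 0.
  have k0 : k != 0.
    apply: contraNneq yp => k0; rewrite dvd3_Fp // yE k0.
    by case: (v) => [[a b] c] /=; rewrite !mul0r.
  apply/eqP; rewrite -(mulrI_eq0 _ (mulfI k0)) -dot3Zl -xbE -xE -map3_rot.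
  rewrite dot3_map3 -(mulrI_eq0 _ (mulfI F2)) /=.
  have -> : 2 = (2 : int)%:~R :> 'F_p by [].
  rewrite -rmorphM -(dvdz_pcharf cp) -(dvdz_mul2l p0) -expr2.
  have -> : p%:Z * (2 * dot3 (qrot q x) w) =
      norm3 y - p%:Z ^+ 2 * (norm3 x + norm3 w).
    by rewrite wE norm3D norm3Z dot3Zr norm3_rot Nq; ring.
  by rewrite rpredB // dvdz_mulr.
rewrite wE qrotD qrotK qrotZ Nq; apply: dvd3D; first exact: dvd3_scalel.
rewrite expr2 dvd3_scale // dvd3_Fp // map3_rot map4_qconj.
by rewrite (rot_conj_eq0 _ F2 v0 vq Nq0 q0) vw.
Qed.

(** * Finite lists of the representations by three squares *)

Definition zrange (K : nat) : seq int := [seq i%:Z - K%:Z | i <- iota 0 (2 * K).+1].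

Lemma mem_zrange K (x : int) : (x \in zrange K) = (`|x| <= K)%N.
Proof.
apply/mapP/idP => [[i]|xK]; first by rewrite mem_iota => iK ->; lia.
by exists (absz (x + K%:Z)); rewrite ?mem_iota; lia.
Qed.

Lemma zrange_uniq K : uniq (zrange K).
Proof. by rewrite map_inj_uniq ?iota_uniq // => i j; lia. Qed.

Definition cube3 (K : nat) : seq (vec3 int) :=
  [seq (xy, z) | xy <- [seq (x, y) | x <- zrange K, y <- zrange K], z <- zrange K].

Lemma mem_pairs (S T : eqType) (s : seq S) (t : seq T) x y :
  ((x, y) \in [seq (a, b) | a <- s, b <- t]) = (x \in s) && (y \in t).
Proof.
apply/allpairsP/andP => [[[a b] [/= sa tb [-> ->]]] //|[sx ty]].
by exists (x, y).
Qed.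

Lemma pairs_uniq (S T : eqType) (s : seq S) (t : seq T) :
  uniq s -> uniq t -> uniq [seq (a, b) | a <- s, b <- t].
Proof. by move=> us ut; apply: allpairs_uniq => // -[? ?] [? ?]. Qed.

Lemma mem_cube3 K x y z :
  ((x, y, z) \in cube3 K) = [&& `|x| <= K, `|y| <= K & `|z| <= K]%N.
Proof. by rewrite !mem_pairs !mem_zrange andbA. Qed.

Lemma cube3_uniq K : uniq (cube3 K).
Proof. by rewrite !pairs_uniq ?zrange_uniq. Qed.

Definition reps3 (n : nat) : seq (vec3 int) :=
  [seq v <- cube3 n | norm3 v == n%:Z].

Lemma norm3_cube3 (K n : nat) v : (n <= K)%N -> norm3 v = n%:Z -> v \in cube3 K.
Proof.
case: v => [[x y] z]; rewrite mem_cube3 /= => nK vn.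
have sq (a : int) : `|a|%N%:Z <= a ^+ 2 /\ 0 <= a ^+ 2 by clear; nia.
by move: (sq x) (sq y) (sq z); lia.
Qed.

Lemma mem_reps3 n v : (v \in reps3 n) = (norm3 v == n%:Z).
Proof.
by rewrite mem_filter andb_idr // => /eqP /norm3_cube3 ->.
Qed.

Lemma reps3_uniq n : uniq (reps3 n).
Proof. by rewrite filter_uniq ?cube3_uniq. Qed.

Definition r3 (n : nat) : nat := size (reps3 n).

Lemma scale3_inj (k : int) : k != 0 -> injective (scale3 k).
Proof.
move=> k0 [[a b] c] [[x y] z] [ha hb hc].
by congr (_, _, _); apply: (mulfI k0).
Qed.

(** The injection [x |-> q x q^*] multiplies norms by [p^2], and [y] is the image of [x] exactly
    when [q^* y q = p^2 x]. *)
Lemma count_rot_image (p n : nat) (q : quat int) : (0 < p)%N -> qnorm q = p%:Z ->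
  count (fun y => dvd3 (p%:Z ^+ 2) (qrot (qconj q) y)) (reps3 (p ^ 2 * n)) = r3 n.
Proof.
move=> p0 Nq.
have pz : p%:Z ^+ 2 != 0 :> int by rewrite expf_neq0 //; move: p0; clear; lia.
rewrite -size_filter /r3 -[RHS](size_map (qrot q)); apply/esym/perm_size/uniq_perm.
- rewrite map_inj_uniq ?reps3_uniq // => x y xy.
  by apply: (scale3_inj pz); rewrite -Nq -!qrotK xy.
- by rewrite filter_uniq ?reps3_uniq.
move=> y; rewrite mem_filter mem_reps3; apply/mapP/andP => [[x]|[]].
  rewrite mem_reps3 => /eqP xn ->.
  by rewrite qrotK norm3_rot Nq dvd3_scalel xn PoszM -rmorphXn.
case/dvd3_scaleP => x xE /eqP Ny; exists x.
  rewrite mem_reps3; apply/eqP; apply: (mulfI pz); apply: (mulfI pz).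
  rewrite mulrA -expr2 -norm3Z -xE norm3_rot.
  have -> : qnorm (qconj q) = qnorm q by case: (q) => [[[a b] c] d] /=; ring.
  by rewrite Nq Ny PoszM -rmorphXn.
by apply: (scale3_inj pz); rewrite -qrotZ -xE qrot_conjK Nq.
Qed.

(** The admissible [v] fill one isotropic line, that of [y] or of [y / p] modulo [p], unless [p^2]
    divides [y], when all [p + 1] lines are admissible. Each line has [p - 1] nonzero vectors. *)
Lemma card_rot_image (p : nat) (Q : vec3 'F_p -> quat int) (y : vec3 int) :
  prime p -> odd p ->
  (forall v, v != (0, 0, 0) -> norm3 v = 0 ->
     qnorm (Q v) = p%:Z /\
     qmul (pure v) (map4 (intmul 1) (Q v)) = (0, 0, 0, 0)) ->
  (p%:Z ^+ 3 %| norm3 y)%Z ->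
  #|[set v : vec3 'F_p | [&& v != (0, 0, 0), norm3 v == 0 &
       dvd3 (p%:Z ^+ 2) (qrot (qconj (Q v)) y)]]| =
  (p.-1 * (1 + dvd3 (p%:Z ^+ 2) y * p))%N.
Proof.
move=> pp op QP Ny.
have p0 : p%:Z != 0 :> int by have := prime_gt0 pp; clear; lia.
have cF : #|'F_p| = p by rewrite card_Fp.
have [/dvd3_scaleP[z zE]|yp] := boolP (dvd3 p y); last first.
  have -> : dvd3 (p%:Z ^+ 2) y = false.
    apply: contraNF yp => /dvd3_scaleP[[[a b] c] ->] /=.
    by rewrite expr2 -!mulrA !dvdz_mulr.
  rewrite mul0n addn0 muln1 -[in RHS]cF.
  rewrite -(@card_isotropic_orthogonal _ (map3 (intmul 1) y)) -?dvd3_Fp //.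
    apply: eq_card => v; rewrite !inE; case: eqVneq => //= v0.
    case: eqP => //= Nv; have [Nq vq] := QP v v0 Nv.
    apply: rot_image_primitive => //.
    by apply: dvdz_trans Ny; rewrite exprS dvdz_mull.
  rewrite norm3_map3; apply/eqP; rewrite -(dvdz_pcharf (pchar_Fp pp)).
  by apply: dvdz_trans Ny; rewrite exprS dvdz_mulr.
rewrite zE expr2 dvd3_scale //.
have imE v : v != (0, 0, 0) -> norm3 v = 0 ->
  dvd3 (p%:Z * p%:Z) (qrot (qconj (Q v)) (scale3 p%:Z z)) =
  (dot3 v (map3 (intmul 1) z) == 0).
  move=> v0 Nv; have [Nq vq] := QP v v0 Nv; exact: rot_image_scaled.
have -> : #|[set v : vec3 'F_p | [&& v != (0, 0, 0), norm3 v == 0 &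
       dvd3 (p%:Z * p%:Z) (qrot (qconj (Q v)) (scale3 p%:Z z))]]| =
    #|[set v : vec3 'F_p | [&& v != (0, 0, 0), norm3 v == 0 &
       dot3 v (map3 (intmul 1) z) == 0]]|.
  apply: eq_card => v; rewrite !inE; case: eqVneq => //= v0.
  by case: eqP => //= Nv; rewrite imE.
have [zp|zp] := boolP (dvd3 p z).
  have z0 : map3 (intmul 1) z = (0, 0, 0) :> vec3 'F_p by apply/eqP; rewrite -dvd3_Fp.
  rewrite mul1n add1n -[in RHS]cF -(card_isotropic_neq0 (Fp2_neq0 pp op)).
  apply: eq_card => v; rewrite !inE z0.
  have -> : dot3 v (0, 0, 0) = 0 by case: v => [[a b] c] /=; rewrite !mulr0 !addr0.
  by rewrite eqxx andbT.
(* Since [norm3 y = p^2 norm3 z], the third power of [p] makes [z] isotropic modulo [p]. *)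
rewrite mul0n addn0 muln1 -[in RHS]cF.
rewrite -(@card_isotropic_orthogonal _ (map3 (intmul 1) z)) -?dvd3_Fp //.
rewrite norm3_map3; apply/eqP; rewrite -(dvdz_pcharf (pchar_Fp pp)).
by move: Ny; rewrite zE norm3Z [_ ^+ 3]exprSr dvdz_mul2l // expf_neq0.
Qed.

(** Pairs of a nonzero isotropic [v] and a vector [y] of norm [p^2 n] in its lattice are counted in
    two ways. The last count stands for [r3 (n / p^2)], read as 0 when the division fails. *)
Lemma r3_hecke (p n : nat) : prime p -> odd p -> (p %| n)%N ->
  (p.+1 * r3 n = r3 (p ^ 2 * n)
     + p * count (dvd3 (p%:Z ^+ 2)) (reps3 (p ^ 2 * n)))%N.
Proof.
move=> pp op pn.
have QE (v : vec3 'F_p) : exists q : quat int,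
    v != (0, 0, 0) -> norm3 v = 0 -> qnorm q = p%:Z /\
    qmul (pure v) (map4 (intmul 1) q) = (0, 0, 0, 0).
  have [/andP[v0 /eqP Nv]|h] := boolP ((v != (0, 0, 0)) && (norm3 v == 0)).
    by have [q Nq vq] := isotropic_quat pp op v0 Nv; exists q.
  (* A dummy value at the other vectors, so that a total function [Q] can be chosen. *)
  by exists (0, 0, 0, 0) => v0 Nv; rewrite v0 Nv eqxx in h.
have [Q QP] := fin_all_exists QE.
pose V := [set v : vec3 'F_p | (v != (0, 0, 0)) && (norm3 v == 0)].
have cV : #|V| = (p.-1 * p.+1)%N.
  by rewrite card_isotropic_neq0 ?Fp2_neq0 // card_Fp.
have : (\sum_(v in V) r3 n = #|V| * r3 n)%N by rewrite sum_nat_const.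
have -> : (\sum_(v in V) r3 n = \sum_(y <- reps3 (p ^ 2 * n))
    p.-1 * (1 + dvd3 (p%:Z ^+ 2)%R y * p))%N.
  transitivity (\sum_(v in V) \sum_(y <- reps3 (p ^ 2 * n))
      dvd3 (p%:Z ^+ 2)%R (qrot (qconj (Q v)) y))%N.
    apply: eq_bigr => v; rewrite inE => /andP[v0 /eqP Nv].
    rewrite -(@count_rot_image p n (Q v)) ?prime_gt0 ?(QP v v0 Nv).1 //.
    by rewrite -sum1_count big_mkcond; apply: eq_bigr => y _; case: dvd3.
  rewrite exchange_big big_seq [RHS]big_seq; apply: eq_bigr => y.
  rewrite mem_reps3 => /eqP Ny; rewrite -(@card_rot_image p Q) //.
    rewrite -big_mkcondr sum1_card; apply: eq_card => v.
    by rewrite unfold_in /= !inE -andbA.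
  case/dvdnP: pn Ny => k -> ->.
  by rewrite exprSr PoszM dvdz_mul // ?PoszM ?dvdz_mull // -rmorphXn.
rewrite -big_distrr /= big_split /= sum1_size -big_distrl /=.
have -> : (\sum_(y <- reps3 (p ^ 2 * n)) dvd3 (p%:Z ^+ 2)%R y =
  count (dvd3 (p%:Z ^+ 2)) (reps3 (p ^ 2 * n)))%N.
  by rewrite -sum1_count [RHS]big_mkcond; apply: eq_bigr => y _; case: dvd3.
rewrite cV -mulnA => /eqP; rewrite eqn_pmul2l; last by have := prime_gt1 pp; lia.
by move/eqP <-; rewrite [(p * _)%N]mulnC.
Qed.

Lemma count_dvd3_reps3 (m n : nat) : (0 < m)%N ->
  count (dvd3 m%:Z) (reps3 (m ^ 2 * n)) = r3 n.
Proof.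
move=> m0.
have mz : m%:Z != 0 :> int by move: m0; clear; lia.
rewrite -size_filter /r3 -[RHS](size_map (scale3 m%:Z)).
apply/esym/perm_size/uniq_perm.
- by rewrite map_inj_uniq ?reps3_uniq //; apply: scale3_inj.
- by rewrite filter_uniq ?reps3_uniq.
move=> y; rewrite mem_filter mem_reps3; apply/mapP/andP => [[x]|[]].
  by rewrite mem_reps3 => /eqP xn ->; rewrite dvd3_scalel norm3Z xn PoszM -rmorphXn.
case/dvd3_scaleP => x -> /eqP Ny; exists x => //.
rewrite mem_reps3; apply/eqP; have /mulfI : m%:Z ^+ 2 != 0 by rewrite expf_neq0.
by apply; rewrite -norm3Z Ny PoszM -rmorphXn.
Qed.

(** A vector divisible by [p^2] has norm divisible by [p^4], and [p^3 N] is not. *)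
Lemma count_dvd3_reps3_coprime (p N : nat) : prime p -> coprime N p ->
  count (dvd3 (p%:Z ^+ 2)) (reps3 (p ^ 2 * (p * N))) = 0%N.
Proof.
move=> pp Np; apply/eqP; rewrite -leqn0 leqNgt -has_count.
apply/negP => /hasP[y]; rewrite mem_reps3 => /eqP Ny /dvd3_scaleP[x xE].
have : (p ^ 2 * (p ^ 2) %| p ^ 2 * (p * N))%N.
  rewrite -[dvdn _ _]/(Posz _ %| Posz _)%Z -Ny xE norm3Z PoszM.
  have -> : (p ^ 2)%N%:Z = p%:Z ^+ 2 by rewrite -rmorphXn.
  by rewrite -expr2 dvdz_mulr.
rewrite dvdn_pmul2l ?expn_gt0 ?prime_gt0 // -mulnn dvdn_pmul2l ?prime_gt0 //.
by apply/negP; rewrite -prime_coprime // coprime_sym.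
Qed.

(** The Hecke relation is the recurrence [x_(k+2) = (1 + p) x_(k+1) - p x_k], solved by geometric
    sums; its second term is absent in the first step. *)
Lemma r3_odd_power (p N k : nat) : prime p -> odd p -> coprime N p ->
  r3 (p ^ (2 * k).+1 * N) = ((\sum_(i < k.+1) p ^ i) * r3 (p * N))%N.
Proof.
move=> pp op Np.
have E j : (p ^ (2 * j.+1).+1 * N = p ^ 2 * (p ^ (2 * j).+1 * N))%N.
  by rewrite mulnA -expnD; congr (p ^ _ * N)%N; lia.
suff [] : r3 (p ^ (2 * k).+1 * N) = ((\sum_(i < k.+1) p ^ i) * r3 (p * N))%N /\
    r3 (p ^ (2 * k.+1).+1 * N) = ((\sum_(i < k.+2) p ^ i) * r3 (p * N))%N by [].
elim: k => [|k [IH0 IH1]].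
  rewrite E muln0 expn1 !big_ord_recr !big_ord0 /= !add0n expn0 expn1 mul1n.
  split=> //; have := r3_hecke pp op (dvdn_mulr N (dvdnn p)).
  by rewrite count_dvd3_reps3_coprime // muln0 addn0 => <-; rewrite add1n.
split=> //; rewrite E.
have pd : (p %| p ^ (2 * k.+1).+1 * N)%N by rewrite expnS -mulnA dvdn_mulr.
have := r3_hecke pp op pd.
have -> : count (dvd3 (p%:Z ^+ 2)) (reps3 (p ^ 2 * (p ^ (2 * k.+1).+1 * N))) =
    r3 (p ^ (2 * k).+1 * N).
  rewrite -(@count_dvd3_reps3 (p ^ 2)) ?expn_gt0 ?prime_gt0 //.
  have -> : (p ^ 2)%N%:Z = p%:Z ^+ 2 by rewrite -rmorphXn.
  by rewrite E mulnA mulnn.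
rewrite IH0 IH1; move: (r3 (p * N)) (r3 (p ^ 2 * _)) => r x.
rewrite ![in RHS]big_ord_recr /= !big_ord_recr /= !expnS.
by move: (\sum_(i < k) p ^ i)%N (p ^ k)%N => S P; clear; lia.
Qed.

(** * Sums of four squares modulo 5 *)

Definition cube4 (K : nat) : seq (quat int) :=
  [seq (xyz, t) | xyz <- cube3 K, t <- zrange K].

Lemma cube4_uniq K : uniq (cube4 K).
Proof. by rewrite pairs_uniq ?cube3_uniq ?zrange_uniq. Qed.

Lemma qnorm_cube4 (K n : nat) q : (n <= K)%N -> qnorm q = n%:Z -> q \in cube4 K.
Proof.
case: q => [[[x y] z] t]; rewrite mem_pairs mem_zrange mem_cube3 /= => nK qn.
have sq (a : int) : `|a|%N%:Z <= a ^+ 2 /\ 0 <= a ^+ 2 by clear; nia.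
by move: (sq x) (sq y) (sq z) (sq t); lia.
Qed.

Definition reps4 (n : nat) : seq (quat int) :=
  [seq q <- cube4 n | qnorm q == n%:Z].

Lemma mem_reps4 n q : (q \in reps4 n) = (qnorm q == n%:Z).
Proof. by rewrite mem_filter andb_idr // => /eqP /qnorm_cube4 ->. Qed.

Lemma reps4_uniq n : uniq (reps4 n).
Proof. by rewrite filter_uniq ?cube4_uniq. Qed.

Definition r4 (n : nat) : nat := size (reps4 n).

Lemma qscale_inj (k : int) : k != 0 -> injective (qscale k).
Proof.
move=> k0 [[[a b] c] d] [[[x y] z] t] [ha hb hc hd].
by congr (_, _, _, _); apply: (mulfI k0).
Qed.

Lemma qdvd_qscaleP (m : int) (q : quat int) :
  qdvd m q -> exists r, q = qscale m r.
Proof.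
case: q => [[[a b] c] d] /= /and4P[/dvdzP[x ->] /dvdzP[y ->] /dvdzP[z ->] /dvdzP[t ->]].
by exists (x, y, z, t); rewrite /= ![m * _]mulrC.
Qed.

Lemma qmulK (R : comPzRingType) (x q : quat R) :
  qmul (qmul x q) (qconj q) = qscale (qnorm q) x.
Proof. case: x q => [[[a b] c] d] [[[e f] g] h]; vec_ring. Qed.

Lemma qmul_conjK (R : comPzRingType) (x q : quat R) :
  qmul (qmul x (qconj q)) q = qscale (qnorm q) x.
Proof. case: x q => [[[a b] c] d] [[[e f] g] h]; vec_ring. Qed.

Lemma qmulZl (R : comPzRingType) (k : R) (q r : quat R) :
  qmul (qscale k q) r = qscale k (qmul q r).
Proof. case: q r => [[[a b] c] d] [[[e f] g] h]; vec_ring. Qed.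

Lemma qnorm_conj (R : comPzRingType) (q : quat R) : qnorm (qconj q) = qnorm q.
Proof. by case: q => [[[a b] c] d] /=; ring. Qed.

(** Membership of [y] in the left ideal of the multiples [x q] amounts to [m] dividing [y q^*]. *)
Lemma count_qmul_image (m n : nat) (q : quat int) : (0 < m)%N -> qnorm q = m%:Z ->
  count (fun y => qdvd m (qmul y (qconj q))) (reps4 (m * n)) = r4 n.
Proof.
move=> m0 Nq.
have mz : m%:Z != 0 :> int by move: m0; clear; lia.
rewrite -size_filter /r4 -[RHS](size_map (fun x => qmul x q)).
apply/esym/perm_size/uniq_perm.
- rewrite map_inj_uniq ?reps4_uniq // => x y xy.
  by apply: (qscale_inj mz); rewrite -Nq -!qmulK xy.
- by rewrite filter_uniq ?reps4_uniq.
move=> y; rewrite mem_filter mem_reps4; apply/mapP/andP => [[x]|[]].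
  rewrite mem_reps4 => /eqP xn ->; rewrite qmulK qnormM xn Nq PoszM mulrC eqxx.
  by split=> //; case: (x) => [[[a b] c] d] /=; rewrite !dvdz_mulr.
case/qdvd_qscaleP => x xE /eqP Ny; exists x.
  rewrite mem_reps4; apply/eqP; apply: (mulfI mz); apply: (mulfI mz).
  by rewrite mulrA -expr2 -qnormZ -xE qnormM qnorm_conj Nq Ny PoszM mulrC.
by apply: (qscale_inj mz); rewrite -qmulZl -xE qmul_conjK Nq.
Qed.

(* Representatives of the six left ideals of norm 5. *)
Definition quats5 : seq (quat int) :=
  [:: (1, 2, 0, 0); (1, -2, 0, 0); (1, 0, 2, 0); (1, 0, -2, 0);
      (1, 0, 0, 2); (1, 0, 0, -2)].

(** Such a quaternion lies in one of the six ideals, or in all six when 5 divides it; both counts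
    are 1 modulo 5. *)
Lemma sum_qdvd5 (y : quat int) : (5 %| qnorm y)%Z ->
  (\sum_(q <- quats5) qdvd 5 (qmul y (qconj q)) = 1 %[mod 5])%N.
Proof.
have p5 : prime 5 by [].
rewrite (dvdz_pcharf (pchar_Fp p5)) -qnorm_map4.
rewrite (eq_bigr (fun q => nat_of_bool (qmul (map4 (intmul 1) y)
    (map4 (intmul 1) (qconj q)) == (0, 0, 0, 0) :> quat 'F_5))); last first.
  by move=> q _; rewrite -map4_qmul -qdvd_Fp.
case: (map4 _ y) => [[[a b] c] d] /eqP Ny; apply/eqP; move: Ny => /eqP.
pose F5 : seq 'F_5 := [:: 0; 1; 2; 3; 4].
have F5P (x : 'F_5) : x \in F5 by case: x => [[|[|[|[|[|]]]]] //].
rewrite -(big_map (fun q => nat_of_bool (qmul (a, b, c, d)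
  (map4 (intmul 1) (qconj q)) == (0, 0, 0, 0))) predT id) -sumnE.
(* Only residues matter, so all 625 quaternions modulo 5 are checked by computation. *)
suff : all (fun y : quat 'F_5 => (qnorm y == 0) ==>
    (sumn [seq nat_of_bool (qmul y (map4 (intmul 1) (qconj q)) == (0, 0, 0, 0))%R
     | q <- quats5] == 1 %[mod 5])%N)
    [seq (xyz, t) | xyz <- [seq (xy, z) | xy <-
       [seq (x, y) | x <- F5, y <- F5], z <- F5], t <- F5].
  by move/allP/(_ (a, b, c, d)); rewrite !mem_pairs !F5P => /(_ isT) /implyP /[apply].
by vm_compute.
Qed.

(** Pairs of an ideal and a vector of norm [5 n] in it number [6 r4(n)] by ideals and, modulo 5,
    [r4(5 n)] by vectors. *)
Lemma r4_mul5 (n : nat) : (r4 (5 * n) = r4 n %[mod 5])%N.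
Proof.
have : (\sum_(q <- quats5) r4 n = 6 * r4 n)%N.
  by rewrite big_const_seq -[count _ _]/6%N iter_addn_0 mulnC.
have -> : (\sum_(q <- quats5) r4 n = \sum_(y <- reps4 (5 * n))
    \sum_(q <- quats5) qdvd 5 (qmul y (qconj q)))%N.
  rewrite exchange_big big_seq [RHS]big_seq; apply: eq_bigr => q qQ.
  rewrite -(@count_qmul_image 5 n q) //; last first.
    have /allP/(_ q qQ)/eqP // : all (fun q => qnorm q == 5) quats5 by [].
  by rewrite -sum1_count big_mkcond; apply: eq_bigr => y _; case: qdvd.
move=> e; have -> : (r4 n = 6 * r4 n %[mod 5])%N by lia.
rewrite -e /r4 -sum1_size -modn_summ [in RHS]big_seq -[in RHS]modn_summ; congr modn.
rewrite [LHS]big_seq; apply: eq_bigr => y; rewrite mem_reps4 => /eqP Ny.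
by apply/esym/sum_qdvd5; rewrite Ny PoszM dvdz_mulr.
Qed.

(** * Gauss' identity *)

Lemma opb_sum m n :
  opb m.+1 n =
  (opb m n + \sum_(1 <= k < n.+1 | k * m.+1 <= n) 2 * opb m (n - k * m.+1))%N.
Proof.
rewrite /=; congr addn; rewrite big_mkcond /=.
set f := (fix mult (k : nat) := _).
have : forall k, f k = (\sum_(1 <= i < k.+1)
    (if i * m.+1 <= n then 2 * opb m (n - i * m.+1) else 0))%N; last by apply.
elim=> [|k IHk]; first by rewrite big_geq.
by rewrite big_nat_recr //= IHk.
Qed.

Lemma opb_gt m n : (n < m.+1)%N -> opb m.+1 n = opb m n.
Proof.
move=> nm; rewrite opb_sum big1_seq ?addn0 // => k /andP[kn].
by rewrite mem_index_iota => /andP[k0 _]; move: kn nm; nia.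
Qed.

(** Coefficient form of [(1 - X^(m+1)) G_(m+1) = (1 + X^(m+1)) G_m] for the generating functions. *)
Lemma opb_rec m n : (m.+1 <= n)%N ->
  opb m.+1 n = (opb m.+1 (n - m.+1) + opb m n + opb m (n - m.+1))%N.
Proof.
move=> mn; rewrite [in RHS]opb_sum opb_sum.
have -> : (\sum_(1 <= k < n.+1 | k * m.+1 <= n) 2 * opb m (n - k * m.+1) =
  2 * opb m (n - m.+1) + \sum_(1 <= k < (n - m.+1).+1 | k * m.+1 <= n - m.+1)
    2 * opb m (n - m.+1 - k * m.+1))%N.
  have E (F : nat -> nat) a b : (a <= b)%N -> (forall k, k * m.+1 <= n - m.+1 -> k <= a)%N ->
      (\sum_(1 <= k < b.+1 | k * m.+1 <= n - m.+1) F k =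
       \sum_(1 <= k < a.+1 | k * m.+1 <= n - m.+1) F k)%N.
    move=> ab h; rewrite (big_cat_nat _ (n := a.+1)) //= [X in (_ + X)%N]big1_seq ?addn0 //.
    by move=> k /andP[/h ka]; rewrite mem_index_iota ltnNge ka.
  rewrite -(E _ (n - m.+1)%N n.-1) //; [|by lia|by move=> k; nia].
  rewrite (prednK (leq_trans (ltn0Sn m) mn)) big_ltn_cond ?ltnS; last by lia.
  rewrite mul1n mn; congr addn; rewrite big_add1; apply: eq_big => k.
    by rewrite mulSn; lia.
  by rewrite mulSn subnDA.
by lia.
Qed.

Lemma opb_stable m n : (n <= m)%N -> opb m n = overpartition n.
Proof.
move=> nm; rewrite -(subnKC nm) /overpartition; elim: (m - n)%N => [|k IHk].
  by rewrite addn0.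
by rewrite addnS opb_gt // ltnS leq_addr.
Qed.

(** * The finite identity and its telescoping sum *)

Definition upper_prod (R : pzRingType) (q : R) (s n : nat) : R :=
  \prod_(s <= k < n) (1 - q ^+ k.+1).
Definition lower_prod (R : pzRingType) (q : R) (n : nat) : R :=
  \prod_(0 <= k < n) (1 + q ^+ k.+1).
Definition partial_theta (R : pzRingType) (q : R) (n : nat) : R :=
  1 + 2 * \sum_(0 <= j < n) (-1) ^+ j.+1 * q ^+ (j.+1 ^ 2).
(** The error term of the finite identity; every summand carries a factor [q^(n+1)]. *)
Definition theta_tail (R : pzRingType) (q : R) (n : nat) : R :=
  \sum_(0 <= t < n) (-1) ^+ t.+1 * q ^+ (t.+1 * n.+1)
    * upper_prod q t.+1 n * lower_prod q t.

(** Each summand is the difference of two consecutive values of the closing term on the right. Its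
    last factor is what comparing [theta_tail] at [n] and [n + 1] produces. *)
Lemma telescope_theta (R : comPzRingType) (q : R) (n m : nat) : (m <= n)%N ->
  \sum_(0 <= t < m) (-1) ^+ t.+1 * q ^+ (t.+1 * n.+1) * upper_prod q t.+1 n
     * lower_prod q t * ((1 + q ^+ n.+1) - q ^+ t.+1 * (1 - q ^+ n.+1))
  = - q ^+ n.+1 * upper_prod q 0 n
    + (-1) ^+ m * q ^+ (m.+1 * n.+1) * upper_prod q m n * lower_prod q m.
Proof.
elim: m => [|m IHm] mn.
  by rewrite big_geq // /lower_prod [\prod_(0 <= _ < 0) _]big_geq // mul1n; ring.
rewrite big_nat_recr //= IHm ?(ltnW mn) //.
have -> : upper_prod q m n = (1 - q ^+ m.+1) * upper_prod q m.+1 n.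
  by rewrite /upper_prod big_ltn.
have -> : lower_prod q m.+1 = lower_prod q m * (1 + q ^+ m.+1).
  by rewrite /lower_prod big_nat_recr.
rewrite [(m.+2 * _)%N]mulSn exprD !(exprS (-1)).
by ring.
Qed.

(* Shanks' finite form of Gauss' identity for [\sum_j (-1)^j q^(j^2)]. *)
Lemma finite_gauss (R : comPzRingType) (q : R) (n : nat) :
  lower_prod q n * partial_theta q n = upper_prod q 0 n + 2 * theta_tail q n.
Proof.
elim: n => [|n IHn].
  by rewrite /lower_prod /partial_theta /upper_prod /theta_tail !big_geq //; ring.
have lowS : lower_prod q n.+1 = lower_prod q n * (1 + q ^+ n.+1).
  by rewrite /lower_prod big_nat_recr.
have upS s : (s <= n)%N -> upper_prod q s n.+1 = upper_prod q s n * (1 - q ^+ n.+1).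
  by move=> sn; rewrite /upper_prod big_nat_recr.
have thS : partial_theta q n.+1 =
    partial_theta q n + 2 * ((-1) ^+ n.+1 * q ^+ (n.+1 ^ 2)).
  by rewrite /partial_theta big_nat_recr //= mulrDr addrA.
(* The summand [t = n] of the longer tail is split off; the others pair with the shorter tail into
   the telescoping sum. *)
have tailS : (1 + q ^+ n.+1) * theta_tail q n - theta_tail q n.+1 =
    - q ^+ n.+1 * upper_prod q 0 n + (-1) ^+ n * q ^+ (n.+1 * n.+1) * lower_prod q n
    - (-1) ^+ n.+1 * q ^+ (n.+1 * n.+2) * lower_prod q n.
  have := @telescope_theta _ q n n (leqnn n).
  rewrite [upper_prod q n n]/upper_prod [\prod_(n <= _ < n) _]big_geq // mulr1 => <-.
  rewrite /theta_tail big_nat_recr //= opprD addrA.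
  rewrite [upper_prod q n.+1 n.+1]/upper_prod [\prod_(n.+1 <= _ < n.+1) _]big_geq // mulr1.
  congr (_ - _); rewrite big_distrr /= -sumrB; apply: eq_big_nat => t /andP[_ tn].
  by rewrite upS // [(t.+1 * n.+2)%N]mulnS exprD; ring.
have tE : theta_tail q n.+1 = (1 + q ^+ n.+1) * theta_tail q n -
   (- q ^+ n.+1 * upper_prod q 0 n + (-1) ^+ n * q ^+ (n.+1 * n.+1) * lower_prod q n
    - (-1) ^+ n.+1 * q ^+ (n.+1 * n.+2) * lower_prod q n).
  by rewrite -tailS; ring.
rewrite lowS thS upS // tE.
rewrite mulrDr [X in X + _](mulrAC _ (1 + q ^+ n.+1)) IHn.
by rewrite -mulnn [(n.+1 * n.+2)%N]mulnS exprD !(exprS (-1)); ring.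
Qed.

(** * Generating functions as polynomials modulo a power of X *)

Lemma dvdp_theta_tail (F : fieldType) (n : nat) :
  dvdp 'X^(n.+1) (theta_tail 'X n : {poly F}).
Proof.
apply: (big_ind (fun g => dvdp 'X^(n.+1) g)) => [|x y|t _];
  [exact: dvdp0 | exact: dvdp_add |].
by rewrite -!mulrA dvdp_mull // dvdp_mulr // mulSn exprD dvdp_mulr.
Qed.

Lemma dvdp_XnP (F : fieldType) (n : nat) (f : {poly F}) :
  reflect (forall i, (i < n)%N -> f`_i = 0) (dvdp 'X^n f).
Proof.
apply: (iffP (dvdpP _ _)) => [[g ->] i lt_in | f0].
  by rewrite coefMXn lt_in.
exists (drop_poly n f); rewrite -[LHS](poly_take_drop n).
suff -> : take_poly n f = 0 by rewrite add0r.
by apply/polyP => i; rewrite coef_take_poly coef0; case: ifP => // /f0.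
Qed.

(** A nonzero constant term makes [g] coprime to [X], hence cancellable modulo [X^n]. *)
Lemma dvdp_Xn_mulr (F : fieldType) (n : nat) (f g : {poly F}) :
  g`_0 != 0 -> dvdp 'X^n (f * g) = dvdp 'X^n f.
Proof.
move=> g0; apply: Gauss_dvdpl; rewrite coprimep_sym coprimep_expr //.
by rewrite coprimepX /root horner_coef0.
Qed.

Definition overpartition_poly (R : nzSemiRingType) (m L : nat) : {poly R} :=
  \poly_(i < L) (opb m i)%:R.

Lemma overpartition_poly_rec (F : fieldType) (m L : nat) :
  dvdp 'X^L ((1 - 'X^(m.+1)) * overpartition_poly F m.+1 L
             - (1 + 'X^(m.+1)) * overpartition_poly F m L).
Proof.
apply/dvdp_XnP => i iL.
rewrite mulrBl mulrDl !mul1r !(coefB, coefD, coefXnM) !coef_poly iL.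
have [im|mi] := ltnP i m.+1; first by rewrite opb_gt // !(subr0, addr0) subrr.
rewrite (leq_ltn_trans (leq_subr _ _) iL) opb_rec // !natrD.
by ring.
Qed.

Lemma overpartition_poly_prod (F : fieldType) (m L : nat) :
  dvdp 'X^L (upper_prod 'X 0 m * overpartition_poly F m L - lower_prod 'X m).
Proof.
elim: m => [|m IHm].
  rewrite /upper_prod /lower_prod !big_geq // mul1r; apply/dvdp_XnP => i iL.
  by rewrite coefB coef_poly iL coef1 /= subrr.
have -> : upper_prod 'X 0 m.+1 * overpartition_poly F m.+1 L - lower_prod 'X m.+1 =
    upper_prod 'X 0 m * ((1 - 'X^(m.+1)) * overpartition_poly F m.+1 L
             - (1 + 'X^(m.+1)) * overpartition_poly F m L)
    + (1 + 'X^(m.+1)) * (upper_prod 'X 0 m * overpartition_poly F m L - lower_prod 'X m).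
  rewrite /upper_prod /lower_prod !big_nat_recr //=; ring.
by rewrite dvdp_add // dvdp_mull // overpartition_poly_rec.
Qed.

Lemma coef0_upper_prod (F : fieldType) (m : nat) :
  (upper_prod 'X 0 m : {poly F})`_0 = 1.
Proof.
rewrite -horner_coef0 horner_prod big1 // => k _.
by rewrite !hornerE expr0n subr0.
Qed.

(** With [U] and [V] the products of the [1 - X^k] and [1 + X^k], [U] times the overpartition series
    is [V] and [V] times theta is [U], modulo [X^L]; then [U] cancels. *)
Lemma gauss_overpartition (F : fieldType) (L : nat) :
  dvdp 'X^L (overpartition_poly F L L * partial_theta 'X L - 1).
Proof.
rewrite -(@dvdp_Xn_mulr _ _ _ (upper_prod 'X 0 L)) ?coef0_upper_prod ?oner_eq0 //.
have -> : (overpartition_poly F L L * partial_theta 'X L - 1) * upper_prod 'X 0 L =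
  (upper_prod 'X 0 L * overpartition_poly F L L - lower_prod 'X L) * partial_theta 'X L
  + (lower_prod 'X L * partial_theta 'X L - upper_prod 'X 0 L) by ring.
rewrite dvdp_add // ?dvdp_mulr ?overpartition_poly_prod //.
rewrite finite_gauss [_ + _ - _]addrAC subrr add0r dvdp_mull //.
by apply: dvdp_trans (dvdp_theta_tail F L); rewrite exprS dvdp_mull.
Qed.

(** * Overpartitions of multiples of 5 *)

(** The sign [(-1)^j] is absorbed into [- X], as [j^2] and [j] have the same parity; powers of
    [theta] become sums of [(- X)^norm]. *)
Definition theta (R : nzRingType) (K : nat) : {poly R} :=
  \sum_(j <- zrange K) (- 'X) ^+ (`|j| ^ 2)%N.

Lemma theta_partial (R : comNzRingType) (K : nat) :
  theta R K = partial_theta 'X K.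
Proof.
elim: K => [|K IHK].
  rewrite /theta /partial_theta big_geq // /zrange big_seq1 -[(_ ^ 2)%N]/0%N.
  by rewrite expr0 mulr0 addr0.
have -> : theta R K.+1 = theta R K + 2 * (- 'X) ^+ (K.+1 ^ 2).
  have pe : perm_eq (zrange K.+1) [:: K.+1%:Z, - K.+1%:Z & zrange K].
    apply: uniq_perm; first exact: zrange_uniq.
      by rewrite 2!cons_uniq zrange_uniq andbT in_cons !mem_zrange; lia.
    by move=> j; rewrite mem_zrange 2!in_cons mem_zrange; lia.
  by rewrite /theta (perm_big _ pe) 2!big_cons /= mulr_natl mulr2n addrA addrC.
rewrite IHK /partial_theta big_nat_recr //= mulrDr addrA (exprNn 'X).
by rewrite -[(-1) ^+ (_ ^ 2)%N]signr_odd oddX orFb signr_odd.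
Qed.

Lemma sign_mul_scale (R : nzRingType) (b : bool) (f : {poly R}) :
  (-1) ^+ b * f = (-1) ^+ b *: f.
Proof. by case: b; rewrite ?scaleN1r ?mulN1r // scale1r mul1r. Qed.

Lemma coef_Nexp (R : comNzRingType) (m n : nat) :
  ((- 'X) ^+ m : {poly R})`_n = (-1) ^+ n * (m == n)%:R.
Proof.
rewrite (exprNn 'X) -[in LHS]signr_odd sign_mul_scale coefZ coefXn eq_sym.
case: eqVneq => [->|]; last by rewrite !mulr0.
by rewrite signr_odd.
Qed.

Lemma abszD_ge0 (x y : int) : 0 <= x -> 0 <= y -> (`|(x + y)%R| = `|x| + `|y|)%N.
Proof. by lia. Qed.

Lemma thetaX3 (R : comNzRingType) (K : nat) :
  theta R K ^+ 3 = \sum_(v <- cube3 K) (- 'X) ^+ `|norm3 v|%N.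
Proof.
rewrite !big_allpairs !exprS expr0 mulr1 mulrA.
rewrite {1 2}/theta big_distrlr /= big_distrl /=; apply: eq_bigr => x _.
rewrite big_distrl /=; apply: eq_bigr => y _.
rewrite /theta big_distrr /=; apply: eq_bigr => z _.
by rewrite -!exprD !abszD_ge0 ?addr_ge0 ?sqr_ge0 // !abszX.
Qed.

Lemma thetaX4 (R : comNzRingType) (K : nat) :
  theta R K ^+ 4 = \sum_(q <- cube4 K) (- 'X) ^+ `|qnorm q|%N.
Proof.
rewrite big_allpairs exprSr thetaX3 big_distrl /=; apply: eq_bigr => -[[x y] z] _.
rewrite /theta big_distrr /=; apply: eq_bigr => t _.
rewrite -exprD -abszX -abszD_ge0 //; last exact: sqr_ge0.
by rewrite !addr_ge0 ?sqr_ge0.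
Qed.

Lemma coef_sum_Nexp (R : comNzRingType) (T : Type) (s : seq T) (f : T -> nat) n :
  (\sum_(t <- s) (- 'X) ^+ f t : {poly R})`_n
    = (-1) ^+ n * (count (fun t => f t == n) s)%:R.
Proof.
rewrite coef_sum -sum1_count natr_sum big_distrr /= [RHS]big_mkcond /=.
by apply: eq_bigr => t _; rewrite coef_Nexp; case: eqP; rewrite ?mulr0.
Qed.

Lemma coef_thetaX3 (R : comNzRingType) (K n : nat) : (n <= K)%N ->
  (theta R K ^+ 3)`_n = (-1) ^+ n * (r3 n)%:R.
Proof.
move=> nK; rewrite thetaX3 coef_sum_Nexp -size_filter; congr (_ * _%:R).
apply/perm_size/uniq_perm; rewrite ?filter_uniq ?cube3_uniq // => v.
rewrite mem_reps3 mem_filter.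
have N0 : 0 <= norm3 v by case: v => [[x y] z]; rewrite /= !addr_ge0 ?sqr_ge0.
have -> : (`|norm3 v|%N == n) = (norm3 v == n%:Z) by move: N0; clear; lia.
by rewrite andb_idr // => /eqP /norm3_cube3 ->.
Qed.

Lemma coef_thetaX4 (R : comNzRingType) (K n : nat) : (n <= K)%N ->
  (theta R K ^+ 4)`_n = (-1) ^+ n * (r4 n)%:R.
Proof.
move=> nK; rewrite thetaX4 coef_sum_Nexp -size_filter; congr (_ * _%:R).
apply/perm_size/uniq_perm; rewrite ?filter_uniq ?cube4_uniq // => q.
rewrite mem_reps4 mem_filter.
have N0 : 0 <= qnorm q by case: q => [[[x y] z] t]; rewrite /= !addr_ge0 ?sqr_ge0.
have -> : (`|qnorm q|%N == n) = (qnorm q == n%:Z) by move: N0; clear; lia.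
by rewrite andb_idr // => /eqP /qnorm_cube4 ->.
Qed.

Lemma coef0_theta (R : comNzRingType) (K : nat) : (theta R K)`_0 = 1.
Proof.
rewrite theta_partial -horner_coef0 /partial_theta !hornerE horner_sum.
rewrite big1_seq ?mulr0 ?addr0 //.
by move=> j _; rewrite hornerM hornerXn expr0n mulr0.
Qed.

Lemma coef_mul_theta (R : comNzRingType) (f : {poly R}) (K n : nat) :
  (f * theta R K)`_n = \sum_(j <- zrange K)
    (-1) ^+ (`|j| ^ 2)%N * (if (`|j| ^ 2 <= n)%N then f`_(n - `|j| ^ 2) else 0).
Proof.
rewrite /theta big_distrr /= coef_sum; apply: eq_bigr => j _.
rewrite (exprNn 'X) mulrCA -[in LHS]signr_odd sign_mul_scale.
by rewrite coefZ coefMXn signr_odd ltnNge; case: leqP.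
Qed.

(** By Frobenius the fifth power has only exponents divisible by 5, so [f] matters only there, just
    as if the series extracted from [f] were multiplied by [theta]. *)
Lemma coef_mul_thetaX5 (f : {poly 'F_5}) (K n : nat) :
  (f * theta 'F_5 K ^+ 5)`_(5 * n) = \sum_(j <- zrange K)
    (-1) ^+ (`|j| ^ 2)%N *
    (if (`|j| ^ 2 <= n)%N then f`_(5 * (n - `|j| ^ 2)) else 0).
Proof.
have p5 : 5%N \in [pchar {poly 'F_5}] by rewrite pchar_poly; exact: pchar_Fp.
rewrite -(pFrobenius_autE p5) /theta raddf_sum /= big_distrr /= coef_sum.
apply: eq_bigr => j _; rewrite pFrobenius_autE -exprM mulnC exprM (exprNn 'X).
have -> : ((-1) ^+ 5 * 'X^5 : {poly 'F_5}) = - 'X^5.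
  by rewrite -signr_odd expr1 mulN1r.
rewrite (exprNn 'X^5) mulrCA -[in LHS]signr_odd sign_mul_scale.
rewrite -exprM coefZ coefMXn signr_odd ltnNge leq_pmul2l // mulnBr.
by case: leqP.
Qed.

Lemma natr_F5_mod (m n : nat) : (m = n %[mod 5])%N -> m%:R = n%:R :> 'F_5.
Proof.
have p5 : prime 5 by [].
by move=> e; rewrite -(Fp_nat_mod p5 m) e (Fp_nat_mod p5 n).
Qed.

(** From [G phi = 1] comes [G phi^5 = phi^4]. Keeping the exponents divisible by 5 gives
    [H phi = phi^4], by Frobenius on the left and [r4_mul5] on the right; cancelling [phi] leaves
    [H = phi^3]. *)
Lemma overpartition_mul5 (n : nat) :
  (overpartition (5 * n))%:R = (-1) ^+ n * (r3 n)%:R :> 'F_5.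
Proof.
(* Working modulo [X^(5 n + 1)] retains the coefficient of [X^(5 n)]. *)
pose L := (5 * n).+1; pose phi := theta 'F_5 L.
pose G := overpartition_poly 'F_5 L L.
pose H : {poly 'F_5} := \poly_(i < n.+1) (overpartition (5 * i))%:R.
have phi0 : phi`_0 != 0 by rewrite coef0_theta oner_eq0.
have GE m : (m <= n)%N -> (G * phi ^+ 5)`_(5 * m) = (phi ^+ 4)`_(5 * m).
  move=> mn; apply/eqP; rewrite -subr_eq0 -coefB; apply/eqP.
  have -> : G * phi ^+ 5 - phi ^+ 4 = (G * phi - 1) * phi ^+ 4 by ring.
  apply: (elimT (dvdp_XnP L _)); last by rewrite ltnS leq_mul2l.
  by rewrite dvdp_mulr // /phi theta_partial gauss_overpartition.
have HE : dvdp 'X^(n.+1) (H - phi ^+ 3).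
  rewrite -(dvdp_Xn_mulr _ _ phi0) mulrBl -exprSr; apply/dvdp_XnP => m.
  rewrite ltnS => mn; rewrite coefB; apply/eqP; rewrite subr_eq0; apply/eqP.
  have mL : (5 * m <= L)%N by rewrite /L; lia.
  transitivity ((phi ^+ 4)`_(5 * m)).
    rewrite -GE // coef_mul_theta coef_mul_thetaX5; apply: eq_bigr => j _.
    case: leqP => // jm; congr (_ * _); rewrite !coef_poly ltnS.
    rewrite (leq_trans (leq_subr _ _) mn) opb_stable; last by rewrite /L; lia.
    by rewrite ifT // /L; lia.
  rewrite !coef_thetaX4 //; last by rewrite /L; lia.
  rewrite -signr_odd oddM /= signr_odd; congr (_ * _).
  exact: natr_F5_mod (r4_mul5 m).
have := (elimT (dvdp_XnP _ _)) HE n (ltnSn n).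
rewrite coefB coef_poly ltnSn coef_thetaX3; last by rewrite /L; lia.
by move/eqP; rewrite subr_eq0 => /eqP.
Qed.

Lemma overpartition_dvd5 (p N k : nat) : prime p -> odd p -> coprime N p ->
  (\sum_(i < k.+1) p ^ i = 0 %[mod 5])%N ->
  (overpartition (5 * p ^ (2 * k).+1 * N) %% 5 = 0)%N.
Proof.
move=> pp op Np Sk; apply/eqP; rewrite -/(5 %| _)%N -mulnA.
rewrite (dvdn_pcharf (pchar_Fp (isT : prime 5))) overpartition_mul5 r3_odd_power //.
by rewrite natrM (natr_F5_mod Sk) mul0r mulr0.
Qed.

(* Vanishing of the geometric sums modulo 5 *)
Local Close Scope ring_scope.

Theorem theorem4 (p N alpha : nat) :
  prime p -> 3 <= p -> 0 < N -> coprime N p ->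
  (p %% 5 = 1 -> overpartition (5 * p ^ (10 * alpha + 9) * N) %% 5 = 0) /\
  (p %% 5 \in [:: 2; 3; 4] ->
     overpartition (5 * p ^ (8 * alpha + 7) * N) %% 5 = 0).
Proof.
move=> pp p3 _ Np.
have op : odd p by case: (even_prime pp) => // p2; rewrite p2 in p3.
split=> p5.
  have -> : 10 * alpha + 9 = (2 * (5 * alpha + 4)).+1 by lia.
  apply: overpartition_dvd5 => //.
  (* There are [5 (alpha + 1)] terms, each 1 modulo 5. *)
  rewrite -modn_summ (eq_bigr (fun=> 1)) => [|i _]; last first.
    by rewrite -modnXm p5 exp1n.
  rewrite sum1_card card_ord; lia.
have -> : 8 * alpha + 7 = (2 * (4 * alpha + 3)).+1 by lia.
apply: overpartition_dvd5 => //.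
(* The terms fall into blocks of four, each a multiple of [1 + p + p^2 + p^3], which is 15, 40 or 85
   for the residues 2, 3 and 4. *)
have -> : (4 * alpha + 3).+1 = 4 * alpha.+1 by lia.
elim: alpha.+1 => [|a IHa]; first by rewrite muln0 big_ord0.
rewrite mulnSr -!(big_mkord xpredT (expn p)) (big_cat_nat _ (n := 4 * a)) ?leq_addr //=.
rewrite big_mkord -modnDml IHa mod0n add0n.
rewrite -[X in index_iota X _]add0n big_addn addnC addnK.
rewrite (eq_bigr (fun i => p ^ i * p ^ (4 * a))) => [|i _]; last by rewrite expnD.
rewrite -big_distrl /= -modnMml.
suff -> : \sum_(0 <= i < 4) p ^ i = 0 %[mod 5] by [].
rewrite -modn_summ (eq_bigr (fun i => (p %% 5) ^ i %% 5)) => [|i _]; last first.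
  by rewrite modnXm.
rewrite !big_nat_recr //= big_geq //.
by move: p5; rewrite !inE => /or3P[] /eqP->.
Qed.
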